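(* Let $A$ be bounded, let $f$ be a valid function on $A\times\mathbb{R}$ that is strictly log-concave with respect to $y$, and consider the pairwise comparison sampling model described in the context (latent scores $u\in\mathbb{R}^n$ with $u_1=0$ and dynamic range $M_n$, comparison counts $n_{ij}\sim\mathrm{Bin}(T,p_{ij,n})$, minimum and maximum comparison rates $p_n,q_n$). Let $g(x;y)=\frac{\partial}{\partial y}\log f(x;y)$, $g_2(x;y)=\frac{\partial}{\partial y}g(x;y)$ and $$\omega_n=\frac{\sup_{x\in A,\,|y|\le M_n}|g(x;y)|}{\inf_{x\in A,\,|y|\le M_n+1}|g_2(x;y)|}.$$ Suppose that the sequence $\max\{M_n,\omega_n,q_n/p_n\}$ is bounded, and that there exist $\epsilon>0$ and $c>0$ such that $$p_n\ge c\,\frac{(\log n)^{3+\epsilon}}{n}\quad\text{for all } n .$$ Then, almost surely, the maximum likelihood estimator $\widehat{u}=\arg\max_{v\in\mathbb{R}^n,\,v_1=0}l(v)$ uniquely exists for all but finitely many $n$, and $\widehat{u}$ is uniformly consistent for $u$ with convergence rate at least of order $(\log n)^{-\epsilon/2}$: there is a constant $C>0$ not depending on $n$ such that for all sufficiently large $n$, with probability at least $1-n^{-2}$, $\|\widehat{u}-u\|_\infty\le C(\log n)^{-\epsilon/2}$.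
   Context: **Link function.** $A\subset\mathbb{R}$ is symmetric ($A=-A$) and is either continuous (integrals over $A$ are with respect to Lebesgue measure) or discrete (integrals $\int\cdot\,dx$ are read as sums over $A$). A function $f:A\times\mathbb{R}\to(0,\infty)$ is *valid* if: (1) $\int_A f(x;y)\,dx=1$ for every $y\in\mathbb{R}$; (2) $f(x;y)=f(-x;-y)$ for all $(x,y)\in A\times\mathbb{R}$; (3) for every $x\in A$ with $x<0$, $f(x;y)$ is decreasing in $y$ and $f(x;y)\to0$ as $y\to\infty$; (4) $\sup_{y\in\mathbb{R}}f(x;y)<\infty$ for every $x\in A$. $f$ is *strictly log-concave with respect to $y$* if for every $x\in A$, $\log f(x;y)$ is twice differentiable in $y$ and $\frac{\partial^2}{\partial y^2}\log f(x;y)<0$ for all $y\in\mathbb{R}$. $A$ and $f$ do not depend on $n$. **Sampling model.** For each $n$ there is a latent score vector $u=(u_1,\dots,u_n)\in\mathbb{R}^n$ (depending on $n$) with $u_1=0$, and $M_n=\max_{i,j}|u_i-u_j|$. $T\ge1$ is a fixed integer. For each pair $i\ne j$ there is a comparison rate $p_{ij,n}=p_{ji,n}\in(0,1]$, with $p_n=\min_{i\neq j}p_{ij,n}$ and $q_n=\max_{i\neq j}p_{ij,n}$. The numbers of comparisons $n_{ij}=n_{ji}$ are independent over pairs $i<j$, with $n_{ij}\sim\mathrm{Bin}(T,p_{ij,n})$. Given $\{n_{ij}\}$, the outcomes $X_{ij}^{(t)}$ ($i<j$, $1\le t\le n_{ij}$) are independent with density (mass function) $f(\cdot\,;u_i-u_j)$,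 and $X_{ji}^{(t)}=-X_{ij}^{(t)}$. The models for all $n$ are defined on a common probability space. **Log-likelihood.** $l(v)=\frac12\sum_{i\ne j}\sum_{t=1}^{n_{ij}}\log f(X_{ij}^{(t)};v_i-v_j)$ for $v\in\mathbb{R}^n$. The inequality on $p_n$ need only hold for those $n$ (all large $n$) for which it is compatible with $p_n\le 1$. *)

(* Defs.v *)
From HB Require Import structures.
From mathcomp Require Import all_boot all_order all_algebra.
From mathcomp Require Import all_classical all_reals all_analysis.

Set Implicit Arguments.
Unset Strict Implicit.
Unset Printing Implicit Defensive.

Import Order.TTheory GRing.Theory Num.Theory.
Import numFieldNormedType.Exports.

Local Open Scope classical_set_scope.
Local Open Scope ring_scope.

Variant outcome_kind := ContinuousOutcomes | DiscreteOutcomes.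

Definition base_integral (R : realType) (kind : outcome_kind) (D : set R)
    (h : R -> R) : \bar R :=
  match kind with
  | ContinuousOutcomes => (\int[lebesgue_measure]_(x in D) (h x)%:E)%E
  | DiscreteOutcomes => \esum_(x in D) (h x)%:E
  end.

(* A topologically discrete subset of R is countable, so [DiscreteOutcomes] covers it. *)
Definition outcome_set (R : realType) (kind : outcome_kind) (A : set R) : Prop :=
  (forall x, A x -> A (- x)) /\
  match kind with
  | ContinuousOutcomes => measurable A
  | DiscreteOutcomes => countable A
  end.

(* [f] is a total function, but only its values on A x R are constrained, and
   outcomes lie in A almost surely. Measurability in the outcome is implicit in "density"; it is automatic
   when A is countable. *)
Record valid (R : realType) (kind : outcome_kind) (A : set R)
    (f : R -> R -> R) : Prop := Valid {
  valid_pos : forall x y, A x -> 0 < f x y ;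
  valid_meas : forall y, measurable_fun A (f ^~ y) ;
  valid_int : forall y, base_integral kind A (f ^~ y) = 1%E ;
  valid_sym : forall x y, A x -> f x y = f (- x) (- y) ;
  valid_decr : forall x, A x -> x < 0 ->
    {homo (f x) : y z / y <= z >-> z <= y} ;
  valid_lim : forall x, A x -> x < 0 -> f x y @[y --> +oo] --> (0 : R) ;
  valid_sup : forall x, A x -> has_ubound (range (f x)) }.

Definition score (R : realType) (f : R -> R -> R) (x : R) : R -> R :=
  (fun y => ln (f x y))^`()%classic.

Definition dscore (R : realType) (f : R -> R -> R) (x : R) : R -> R :=
  (score f x)^`()%classic.

(* The differentiability clauses make the total operator [derive1] in [score]
   and [dscore] meaningful on A. *)
Definition strictly_log_concave (R : realType) (A : set R)
    (f : R -> R -> R) : Prop :=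
  forall x y, A x ->
    [/\ derivable (fun z => ln (f x z)) y 1,
        derivable (score f x) y 1
      & dscore f x y < 0].

Definition dynamic_range (R : realType) (n : nat) (u : 'rV[R]_n) : R :=
  \big[Num.max/0]_(ij : 'I_n * 'I_n) `|u ord0 ij.1 - u ord0 ij.2|.

(* Rates lie in (0, 1], so for n >= 2 the default values 1 and 0 do not affect
   the minimum and the maximum. *)
Definition min_rate (R : realType) (n : nat) (p : 'I_n -> 'I_n -> R) : R :=
  \big[Num.min/1]_(ij : 'I_n * 'I_n | ij.1 != ij.2) p ij.1 ij.2.

Definition max_rate (R : realType) (n : nat) (p : 'I_n -> 'I_n -> R) : R :=
  \big[Num.max/0]_(ij : 'I_n * 'I_n | ij.1 != ij.2) p ij.1 ij.2.

(* Extended-real valued: [omega] is +oo when the supremum is infinite or the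
   infimum is zero (the supremum is positive for a valid strictly log-concave
   f, and 0^-1 = +oo in \bar R). *)
Definition omega (R : realType) (A : set R) (f : R -> R -> R) (M : R) : \bar R :=
  (ereal_sup [set (`|score f xy.1 xy.2|)%:E | xy in
     [set xy : R * R | A xy.1 /\ (`|xy.2| <= M)%R]]
   / ereal_inf [set (`|dscore f xy.1 xy.2|)%:E | xy in
     [set xy : R * R | A xy.1 /\ (`|xy.2| <= M + 1)%R]])%E.

Definition cond_prob (R : realType) (d : measure_display)
    (Omega : measurableType d) (P : probability Omega R) (E : set Omega) :
    set Omega -> \bar R :=
  fun F => (P (F `&` E) / P E)%E.

(* [Q] is a set function so that it can be a conditional probability. *)
Definition mutually_independent (R : realType) (d d' : measure_display)
    (Omega : measurableType d) (S : measurableType d') (Q : set Omega -> \bar R)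
    (I : finType) (D : {set I}) (Y : I -> Omega -> S) : Prop :=
  forall (J : {set I}) (B : I -> set S), J \subset D ->
    (forall i, measurable (B i)) ->
    Q (\bigcap_(i in [set` J]) (Y i @^-1` B i)) =
    (\prod_(i in J) Q (Y i @^-1` B i))%E.

Definition has_density (R : realType) (d : measure_display)
    (Omega : measurableType d) (Q : set Omega -> \bar R) (Y : Omega -> R)
    (kind : outcome_kind) (A : set R) (h : R -> R) : Prop :=
  forall B : set R, measurable B -> Q (Y @^-1` B) = base_integral kind (A `&` B) h.

Definition counts_event (Omega : Type) (n : nat)
    (N : 'I_n -> 'I_n -> Omega -> nat) (k : 'I_n -> 'I_n -> nat) : set Omega :=
  [set w | forall i j : 'I_n, (i < j)%N -> N i j w = k i j].

Definition anchored (R : realType) (n : nat) (v : 'rV[R]_n) : Prop :=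
  forall i : 'I_n, i = 0%N :> nat -> v ord0 i = 0.

(* Outcomes of a pair are numbered from 0, so the observed ones are those with
   t < N i j; [X i j t] is unconstrained for larger t. *)
Record sampling_model (R : realType) (kind : outcome_kind) (A : set R)
    (f : R -> R -> R) (T : nat) (d : measure_display) (Omega : measurableType d)
    (P : probability Omega R) (n : nat) (u : 'rV[R]_n)
    (p : 'I_n -> 'I_n -> R) (N : 'I_n -> 'I_n -> {RV P >-> nat})
    (X : 'I_n -> 'I_n -> nat -> {RV P >-> R}) : Prop := SamplingModel {
  model_anchored : anchored u ;
  rate_sym : forall i j, i != j -> p i j = p j i ;
  rate_range : forall i j, i != j -> 0 < p i j <= 1 ;
  count_sym : forall i j w, i != j -> N i j w = N j i w ;
  count_indep : mutually_independent P
    [set ij : 'I_n * 'I_n | (ij.1 < ij.2)%N]%SET (fun ij => N ij.1 ij.2) ;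
  count_binomial : forall i j : 'I_n, (i < j)%N -> forall B : set nat,
    P (N i j @^-1` B) = binomial_prob T (p i j) B ;
  outcome_antisym : forall i j t w, i != j -> (t < N i j w)%N ->
    X j i t w = - X i j t w ;
  outcome_indep : forall k : 'I_n -> 'I_n -> nat,
    P (counts_event N k) != 0%E ->
    mutually_independent (cond_prob P (counts_event N k))
      [set ijt : 'I_n * 'I_n * 'I_T |
        (ijt.1.1 < ijt.1.2)%N && (ijt.2 < k ijt.1.1 ijt.1.2)%N]%SET
      (fun ijt => X ijt.1.1 ijt.1.2 ijt.2) ;
  outcome_density : forall k : 'I_n -> 'I_n -> nat,
    P (counts_event N k) != 0%E ->
    forall (i j : 'I_n) (t : nat), (i < j)%N -> (t < k i j)%N ->
    has_density (cond_prob P (counts_event N k)) (X i j t) kind A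
      (f ^~ (u ord0 i - u ord0 j)) }.

Definition loglik (R : realType) (f : R -> R -> R) (n : nat)
    (N : 'I_n -> 'I_n -> nat) (X : 'I_n -> 'I_n -> nat -> R)
    (v : 'rV[R]_n) : R :=
  2^-1 * \sum_(i < n) \sum_(j < n | i != j) \sum_(t < N i j)
    ln (f (X i j t) (v ord0 i - v ord0 j)).

Definition is_mle (R : realType) (f : R -> R -> R) (n : nat)
    (N : 'I_n -> 'I_n -> nat) (X : 'I_n -> 'I_n -> nat -> R)
    (v : 'rV[R]_n) : Prop :=
  anchored v /\ forall v', anchored v' -> loglik f N X v' <= loglik f N X v.

(* Main.v *)
Require Import Defs.
From HB Require Import structures.
From mathcomp Require Import all_boot all_order all_algebra.
From mathcomp Require Import all_classical all_reals all_analysis.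
From mathcomp Require Import measurable_realfun.
From mathcomp Require Import ring lra.

(**
  Write delta = v - u for a maximiser v of the log-likelihood over the compact
  set of anchored vectors with max delta - min delta <= 1.  Shifting an upper
  level set S of delta slightly down stays in this set, so the score summed over
  the pairs across the cut (S, S^c) is nonnegative at v; at u the same sum is
  noise.  Strong concavity then bounds the total drop of delta across the cut by
  the noise, which is of order |S| sqrt(n p_n log n), whereas the cut contains at
  least of the order of |S| n p_n comparisons when |S| <= n / 2.  Hence at least
  half of these comparisons lead to items within eta ~ sqrt(log n / (n p_n)) of
  S, and since degrees are O(n q_n) = O(n p_n), lowering the threshold by eta
  multiplies |S| by a constant factor larger than 1.  After O(log n) steps, from
  the top as well as from the bottom, more than half of the items are reached, so
  max delta - min delta = O(eta log n) = O((log n)^(-eps/2)).  This is less than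
  1, so v is interior and, by concavity, the global maximiser.

  The cut sizes, the degrees and the noise are controlled by exponential moments
  and a union bound over S, where the bounds are of the form n^(-5 |S|).
*)

Set Implicit Arguments.
Unset Strict Implicit.
Unset Printing Implicit Defensive.

Import Order.TTheory GRing.Theory Num.Theory.
Import numFieldNormedType.Exports.

Local Open Scope classical_set_scope.
Local Open Scope ring_scope.

(** * Level sets of a vector on a weighted graph *)

(** [omega] controls the curvature only for |y| <= M_n + 1, and nothing bounds a global maximiser in
    advance. Strong concavity is therefore used only on vectors whose deviation from u has spread at
    most 1, and existence of the estimator comes from compactness instead of a connectivity
    condition on the observed outcomes. The exponent 3 + eps pays for the accumulated error: with L
    = log n, eta is of order sqrt(L / (n p_n)), hence at most of order L^(-1 - eps/2), and the order
    L many steps cost one more factor L. The noise is treated with the counts frozen. Its variance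
    proxy, proportional to the number of comparisons in the cut, is itself random, so it is
    subtracted inside the exponent and bounded afterwards through the degrees. Bounds geometric in
    |S| make the union over all S as cheap, up to a constant, as a union over single items; the
    exponent 5 then leaves room for a failure probability n^(-2). *)

Lemma level_set_growth (R : realType) (n : nat) (a : 'I_n -> 'I_n -> R)
    (x : 'I_n -> R) (m D eta t : R) (S := [set i | t <= x i]%SET) :
  (forall i j, 0 <= a i j) -> 0 < m -> 0 < D -> 0 < eta ->
  m * #|S|%:R <= \sum_(i in S) \sum_(j in ~: S) a i j ->
  (forall j, \sum_(i | i != j) a i j <= D * m) ->
  \sum_(i in S) \sum_(j in ~: S) a i j * (x i - x j)
    <= eta / 2 * m * #|S|%:R ->
  (1 + (2 * D)^-1) * #|S|%:R <= #|[set i | (t - eta <= x i)%R]%SET|%:R :> R.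
Proof.
move=> a0 m0 D0 eta0 cut deg drop.
set S' := [set i | (t - eta <= x i)%R]%SET.
have sSS' : (S \subset S')%SET.
  by apply/fintype.subsetP => i; rewrite !inE => ?; lra.
(* Markov's inequality: an edge from [S] to the outside of [S'] has drop at least [eta], so these
   edges carry at most half of the guaranteed cut weight [m * #|S|]. *)
have far : \sum_(i in S) \sum_(j in ~: S) a i j * (j \notin S')%:R
    <= m * #|S|%:R / 2.
  rewrite -(ler_pM2l eta0); apply: (@le_trans _ _ (eta / 2 * m * #|S|%:R)); last by lra.
  apply: le_trans drop; rewrite mulr_sumr ler_sum// => i iS.
  rewrite mulr_sumr ler_sum// => j jS; rewrite mulrCA ler_wpM2l//.
  move: iS jS; rewrite !inE -!ltNge => iS jS.
  by case: ltP => ? /=; lra.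
(* The remaining cut edges end in [S' :\: S], where each item absorbs at most its degree [D * m]; so
   at least [#|S| / (2 * D)] items must lie there. *)
have near : \sum_(i in S) \sum_(j in ~: S) a i j * (j \in S')%:R
    <= D * m * (#|S'|%:R - #|S|%:R).
  rewrite exchange_big/=.
  have -> : #|S'|%:R - #|S|%:R = #|(S' :\: S)%SET|%:R :> R.
    by rewrite cardsD (finset.setIidPr sSS') natrB// subset_leq_card.
  rewrite mulrC -[#|_|%:R]sumr_const mulr_suml.
  rewrite big_mkcond/= [leRHS]big_mkcond/= ler_sum// => j _.
  rewrite !inE; have [jS'|_] := boolP (t - eta <= x j); last first.
    by rewrite andbF; case: ifP => // _; rewrite big1// => i _; rewrite mulr0.
  rewrite andbT; case: ifP => // jS; rewrite mul1r.
  apply: le_trans (deg j); rewrite big_mkcond/= [leRHS]big_mkcond/=.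
  rewrite ler_sum// => i _; rewrite mulr1.
  case: ifP => [iS|_]; last by case: ifP.
  case: eqVneq => // ij; move: jS; rewrite -ij.
  by rewrite inE in iS; rewrite iS.
have : m * #|S|%:R <= D * m * (#|S'|%:R - #|S|%:R) + m * #|S|%:R / 2.
  apply: le_trans cut _; apply: le_trans (lerD near far).
  rewrite -big_split/= ler_sum// => i _; rewrite -big_split/= ler_sum// => j _.
  by rewrite -mulrDr; case: (j \in S'); rewrite !(addr0, add0r) mulr1.
rewrite -subr_ge0 => h; rewrite mulrDl mul1r -lerBrDl.
rewrite ler_pdivrMl ?mulr_gt0//.
by rewrite -(ler_pM2l m0); lra.
Qed.

(** Growth is available only while the level set has at most n / 2 items, hence the induction proves
    an alternative: majority reached, or geometric size. At step [l] the geometric alternative would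
    exceed n. *)
Lemma level_set_reach (R : realType) (n : nat) (a : 'I_n -> 'I_n -> R)
    (x : 'I_n -> R) (m D eta t : R) (l : nat) :
  (forall i j, 0 <= a i j) -> 0 < m -> 0 < D -> 0 < eta ->
  (forall S : {set 'I_n}, S != finset.set0 -> (2 * #|S| <= n)%N ->
     m * #|S|%:R <= \sum_(i in S) \sum_(j in ~: S) a i j) ->
  (forall j, \sum_(i | i != j) a i j <= D * m) ->
  (forall t, let S := [set i | t <= x i]%SET in
     S != finset.set0 -> (2 * #|S| <= n)%N ->
     \sum_(i in S) \sum_(j in ~: S) a i j * (x i - x j)
       <= eta / 2 * m * #|S|%:R) ->
  (exists i, t <= x i) ->
  n%:R < (1 + (2 * D)^-1) ^+ l ->
  (n < 2 * #|[set i | (t - l%:R * eta <= x i)%R]%SET|)%N.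
Proof.
move=> a0 m0 D0 eta0 cut deg drop [i0 ti0] nl.
set S := fun k : nat => [set i | (t - k%:R * eta <= x i)%R]%SET.
have mono k : (S k \subset S k.+1)%SET.
  apply/fintype.subsetP => i; rewrite !inE -[k.+1%:R]natr1 => ?.
  by nra.
have Sn0 k : S k != finset.set0.
  apply/set0Pn; exists i0; rewrite inE; apply: le_trans ti0.
  by rewrite gerBl mulr_ge0// ltW.
suff: forall k, (n < 2 * #|S k|)%N \/ (1 + (2 * D)^-1) ^+ k <= #|S k|%:R.
  move=> /(_ l)[//|h]; have := lt_le_trans nl h.
  by rewrite ltr_nat ltnNge -[n in (_ <= n)%N]card_ord max_card.
elim=> [|k [IH|IH]].
- by right; rewrite expr0 ler1n card_gt0.
- by left; apply: leq_trans IH _; rewrite leq_mul// subset_leq_card.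
have [|Sk] := ltnP n (2 * #|S k|)%N.
  by left; apply: leq_trans (_ : 2 * #|S k| <= _)%N; rewrite // leq_mul// subset_leq_card.
right; have := @level_set_growth R n a x m D eta (t - k%:R * eta) a0 m0 D0 eta0
  (cut _ (Sn0 k) Sk) deg (drop _ (Sn0 k) Sk).
have -> : t - k%:R * eta - eta = t - k.+1%:R * eta by rewrite -natr1; ring.
move=> /(le_trans _); apply.
by rewrite exprS ler_wpM2l// addr_ge0// invr_ge0 mulr_ge0// ltW.
Qed.

(* More than half of the coordinates are close to any high value and more than
   half are close to any low value, so some coordinate is close to both. *)
Lemma spread_bound (R : realType) (n : nat) (a : 'I_n -> 'I_n -> R)
    (x : 'I_n -> R) (m D eta : R) (l : nat) :
  (forall i j, 0 <= a i j) -> 0 < m -> 0 < D -> 0 < eta ->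
  (forall S : {set 'I_n}, S != finset.set0 -> (2 * #|S| <= n)%N ->
     m * #|S|%:R <= \sum_(i in S) \sum_(j in ~: S) a i j) ->
  (forall j, \sum_(i | i != j) a i j <= D * m) ->
  (forall t, let S := [set i | t <= x i]%SET in
     S != finset.set0 -> (2 * #|S| <= n)%N ->
     \sum_(i in S) \sum_(j in ~: S) a i j * (x i - x j)
       <= eta / 2 * m * #|S|%:R) ->
  (forall t, let S := [set i | x i <= t]%SET in
     S != finset.set0 -> (2 * #|S| <= n)%N ->
     \sum_(i in S) \sum_(j in ~: S) a i j * (x j - x i)
       <= eta / 2 * m * #|S|%:R) ->
  n%:R < (1 + (2 * D)^-1) ^+ l ->
  forall i j, x i - x j <= 2 * l%:R * eta.
Proof.
move=> a0 m0 D0 eta0 cut deg up down nl i j.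
have hup : (n < 2 * #|[set k | (x i - l%:R * eta <= x k)%R]%SET|)%N.
  by apply: (level_set_reach a0 m0 D0 eta0 cut deg up) => //; exists i.
have hdown :
    (n < 2 * #|[set k | (- x j - l%:R * eta <= - x k)%R]%SET|)%N.
  (* The lower level sets of [x] are the upper level sets of its negative, with the same drops. *)
  apply: (level_set_reach a0 m0 D0 eta0 cut deg _ _ nl) => [t S S0 Sn|]; last first.
    by exists j.
  have SE : S = [set k | x k <= - t]%SET.
    by apply/setP => k; rewrite !inE lerNr.
  rewrite SE in S0 Sn *; apply: le_trans (down _ S0 Sn).
  rewrite le_eqVlt; apply/orP; left; apply/eqP.
  by do 2!apply: eq_bigr => ? _; congr (_ * _); lra.
set U := [set k | _]%SET in hup; set V := [set k | _]%SET in hdown.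
have /set0Pn[k] : (U :&: V)%SET != finset.set0.
  apply/negP => /eqP UV; have := cardsUI U V; rewrite UV cards0 addn0 => UVE.
  have : (#|(U :|: V)%SET| <= n)%N by rewrite -[leqRHS]card_ord max_card.
  rewrite UVE => h; have := leq_add hup hdown.
  rewrite -mulnDr addSn addnS => h2.
  have : (n + n < 2 * n)%N.
    by apply: leq_trans (leq_trans h2 _); rewrite ?leq_mul2l//; exact: leqnSn.
  by rewrite mul2n addnn ltnn.
rewrite !inE => /andP[]; lra.
Qed.

(** * Maximisers of pairwise concave objectives *)

Definition pair_objective (R : realType) (n : nat)
    (W : 'I_n -> 'I_n -> R -> R) (v : 'rV[R]_n) : R :=
  \sum_(i < n) \sum_(j < n | i != j) W i j (v ord0 i - v ord0 j).

(** Pairs on one side of the cut have coefficient zero, and antisymmetry makes the two orientations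
    of a crossing pair contribute equally. When [H] consists of scores, the left side is the
    derivative of the objective along the indicator of [U]. *)
Lemma sum_cut_antisym (R : realType) (n : nat) (U : {set 'I_n})
    (H : 'I_n -> 'I_n -> R) :
  (forall i j, i != j -> H i j = - H j i) ->
  \sum_(i < n) \sum_(j < n | i != j) ((i \in U)%:R - (j \in U)%:R) * H i j
    = 2 * \sum_(i in U) \sum_(j in ~: U) H i j.
Proof.
move=> HN.
set c := \sum_(i in U) _.
have E1 : c =
    \sum_i \sum_(j | i != j) ((i \in U) && (j \notin U))%:R * H i j.
  rewrite /c big_mkcond/=; apply: eq_bigr => i _; case: ifP => iU /=; last first.
    by rewrite big1// => j _; rewrite mul0r.
  rewrite big_mkcond/= [RHS]big_mkcond/=; apply: eq_bigr => j _.
  rewrite inE; case: eqVneq => [<-|_]; first by rewrite iU.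
  by case: (j \in U); rewrite /= ?mul0r ?mul1r.
have E2 : c = \sum_i \sum_(j | i != j) - (((j \in U) && (i \notin U))%:R * H i j).
  rewrite E1 (exchange_big_dep xpredT)//=; apply: eq_bigr => i _.
  under eq_bigl do rewrite eq_sym.
  by apply: eq_bigr => j ij; rewrite [H j i]HN 1?eq_sym// mulrN.
rewrite mulr_natl mulr2n {1}E1 E2 -big_split/=; apply: eq_bigr => i _.
rewrite -big_split/=.
apply: eq_bigr => j _; case: (i \in U); case: (j \in U) => /=; lra.
Qed.

(* Concavity: moving the block [U] down by [s] changes the objective by at
   least [- 2 s] times the score across the cut at the new point. *)
Lemma cut_score_ge0 (R : realType) (n : nat) (W G : 'I_n -> 'I_n -> R -> R)
    (v : 'rV[R]_n) (U : {set 'I_n}) (s k : R) :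
  0 < s ->
  (forall i j y, i != j -> G i j y = - G j i (- y)) ->
  (forall i j y z, i != j -> W i j z <= W i j y + G i j y * (z - y)) ->
  pair_objective W (\row_i (v ord0 i - s * ((i \in U)%:R - k)))
    <= pair_objective W v ->
  0 <= \sum_(i in U) \sum_(j in ~: U) G i j (v ord0 i - v ord0 j - s).
Proof.
move=> s0 GN tan; set v' := \row_i _; rewrite -subr_ge0 => hv.
pose H i j := G i j (v' ord0 i - v' ord0 j).
have HE : \sum_(i in U) \sum_(j in ~: U) G i j (v ord0 i - v ord0 j - s) =
    \sum_(i in U) \sum_(j in ~: U) H i j.
  apply: eq_bigr => i iU; apply: eq_bigr => j; rewrite inE => jU.
  by rewrite /H !mxE iU (negbTE jU)/=; congr (G i j _); ring.
rewrite HE; have HN i j : i != j -> H i j = - H j i.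
  by move=> ij; rewrite /H GN// opprB.
have := sum_cut_antisym U HN.
set c := \sum_(i in U) _ => cE.
suff : 0 <= s * (2 * c) by rewrite pmulr_rge0// pmulr_rge0.
rewrite -cE mulr_sumr; apply: le_trans hv _; rewrite /pair_objective -sumrB.
apply: ler_sum => i _; rewrite mulr_sumr -sumrB; apply: ler_sum => j ij.
rewrite lerBlDl; apply: le_trans (tan i j (v' ord0 i - v' ord0 j) _ ij) _.
rewrite lerD2l -/(H i j) le_eqVlt; apply/orP; left; apply/eqP.
rewrite mulrA [RHS]mulrC; congr (_ * _); rewrite /v' !mxE; ring.
Qed.

(** The width 1 matches the margin in [M + 1]: differences of coordinates of a vector in the box
    stay within the range where the curvature is bounded below. Imposed on all ordered pairs, the
    inequality also bounds absolute values. *)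
Definition anchored_box (R : realType) (n : nat) (u : 'rV[R]_n) : set 'rV[R]_n :=
  [set v | anchored v /\ forall i j,
    (v ord0 i - u ord0 i) - (v ord0 j - u ord0 j) <= 1].

(** The score across the cut is nonnegative just below the maximiser and, by the curvature bound,
    has decreased since [u] by at least [sigma] times the weighted drop; the error due to the shift
    [s] vanishes as [s] tends to 0. The shift must stay in the box, which is why [U] has to be an
    upper set of the deviation. *)
Lemma cut_drop (R : realType) (n : nat) (W G : 'I_n.+1 -> 'I_n.+1 -> R -> R)
    (a : 'I_n.+1 -> 'I_n.+1 -> R) (u v : 'rV[R]_n.+1) (M sigma : R)
    (U : {set 'I_n.+1}) :
  (forall i j, 0 <= a i j) -> 0 < sigma ->
  (forall i j y, i != j -> G i j y = - G j i (- y)) ->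
  (forall i j y z, i != j -> W i j z <= W i j y + G i j y * (z - y)) ->
  (forall i j y z, i != j -> - (M + 1) <= y -> y <= z -> z <= M + 1 ->
     G i j z - G i j y <= - (sigma * a i j * (z - y))) ->
  (forall i j, `|u ord0 i - u ord0 j| <= M) ->
  anchored_box u v ->
  (forall v', anchored_box u v' -> pair_objective W v' <= pair_objective W v) ->
  (forall i j, i \in U -> j \notin U ->
     v ord0 j - u ord0 j < v ord0 i - u ord0 i) ->
  sigma * \sum_(i in U) \sum_(j in ~: U)
      a i j * ((v ord0 i - u ord0 i) - (v ord0 j - u ord0 j))
    <= \sum_(i in U) \sum_(j in ~: U) G i j (u ord0 i - u ord0 j).
Proof.
move=> a0 sigma0 GN tan slope uM [vanch vbox] vmax upper.
set x := fun i => v ord0 i - u ord0 i.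
(* The smallest gap across the cut. Shifts up to [s0] keep the crossing differences above those of
   [u], as [slope] requires; the default 1 of the minimum helps to keep the shifted vector in the
   box. *)
have [s0 [s00 s01 gap]] : exists s0 : R, [/\ 0 < s0, s0 <= 1 &
    forall i j, i \in U -> j \notin U -> s0 <= x i - x j].
  exists (\big[Num.min/1]_(ij : 'I_n.+1 * 'I_n.+1 |
      (ij.1 \in U) && (ij.2 \notin U)) (x ij.1 - x ij.2)); split.
  - by apply/lt_bigmin => // -[i j] /= /andP[iU jU]; rewrite subr_gt0 upper.
  - by apply/bigmin_leP; left.
  - move=> i j iU jU; apply/bigmin_leP; right; exists (i, j) => //=.
    by rewrite iU jU.
set e := \sum_(i in U) \sum_(j in ~: U) a i j.
have e0 : 0 <= e by apply: sumr_ge0 => i _; exact: sumr_ge0.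
suff key s : 0 < s -> s <= s0 ->
    sigma * (\sum_(i in U) \sum_(j in ~: U) a i j * (x i - x j)) <=
    \sum_(i in U) \sum_(j in ~: U) G i j (u ord0 i - u ord0 j) + s * (sigma * e).
  apply/ler_addgt0Pr => t t0.
  have se0 : 0 <= sigma * e by rewrite mulr_ge0// ltW.
  have s1 : 0 < Num.min s0 (t / (sigma * e + 1)).
    by rewrite lt_min s00/= divr_gt0// ltr_wpDl.
  apply: (le_trans (key _ s1 _)); first by rewrite ge_min lexx.
  rewrite lerD2l; apply: (@le_trans _ _ (t / (sigma * e + 1) * (sigma * e))).
    by rewrite ler_wpM2r// ge_min lexx orbT.
  rewrite mulrAC ler_pdivrMr ?ltr_wpDl//.
  by rewrite ler_wpM2l ?lerDl// ltW.
move=> sgt0 ss0.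
have : 0 <= \sum_(i in U) \sum_(j in ~: U) G i j (v ord0 i - v ord0 j - s).
  (* The correction [(ord0 \in U)%:R] is common to all coordinates: it leaves differences unchanged
     and keeps coordinate 0 at 0. *)
  apply: (@cut_score_ge0 _ _ W G v U s (ord0 \in U)%:R) => //; apply: vmax.
  split=> [i i0|i j].
    have -> : i = ord0 by apply/val_inj.
    by rewrite mxE vanch// subrr mulr0 subr0.
  rewrite !mxE; have := vbox i j; have := vbox j i.
  have [iU|iU] := boolP (i \in U); have [jU|jU] := boolP (j \in U) => /=; try lra.
  by have := upper _ _ jU iU; lra.
rewrite !mulr_sumr => /le_trans hle; rewrite -subr_ge0; apply: hle.
rewrite -big_split -sumrB/=; apply: ler_sum => i iU.
rewrite !mulr_sumr -big_split -sumrB/=; apply: ler_sum => j; rewrite inE => jU.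
have ij : i != j by apply: contra jU => /eqP <-.
have := gap _ _ iU jU; rewrite /x => gij.
have /andP[u1 u2] : - M <= u ord0 i - u ord0 j <= M by rewrite -ler_norml.
have := vbox i j => vij.
have h : G i j (v ord0 i - v ord0 j - s) - G i j (u ord0 i - u ord0 j) <=
    - (sigma * a i j * (v ord0 i - v ord0 j - s - (u ord0 i - u ord0 j))).
  by apply: slope => //; lra.
move: h; set G1 := G i j _; set G2 := G i j _.
by lra.
Qed.

Lemma continuous_sum_fin (R : realType) (T : topologicalType) (I : Type)
    (r : seq I) (Q : pred I) (h : I -> T -> R) :
  (forall i, Q i -> continuous (h i)) ->
  continuous (fun x => \sum_(i <- r | Q i) h i x).
Proof.
move=> hc; elim: r => [|i r IH] x.
  by rewrite (_ : (fun _ => _) = cst 0);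
    [exact: cst_continuous|apply/funext => ?; rewrite big_nil].
rewrite (_ : (fun _ => _) = if Q i then h i \+ (fun x => \sum_(i <- r | Q i) h i x)
    else (fun x => \sum_(i <- r | Q i) h i x)); last first.
  by apply/funext => y; rewrite big_cons; case: ifP.
by case: ifPn => Qi; [apply: cvgD; [exact: hc|exact: IH]|exact: IH].
Qed.

Lemma coord_dist_continuous (R : realType) (n : nat) (i j : 'I_n) :
  continuous (fun v : 'rV[R]_n => v ord0 i - v ord0 j).
Proof.
move=> v; apply: (@cvgB _ _ _ (nbhs v) _ (fun v : 'rV[R]_n => v ord0 i)
  (fun v : 'rV[R]_n => v ord0 j)); exact: (@coord_continuous R 1 n ord0).
Qed.

Lemma pair_objective_continuous (R : realType) (n : nat)
    (W : 'I_n -> 'I_n -> R -> R) :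
  (forall i j, i != j -> continuous (W i j)) -> continuous (pair_objective W).
Proof.
move=> Wc; rewrite /pair_objective; apply: continuous_sum_fin => i _.
apply: continuous_sum_fin => j ij v.
by apply: continuous_comp; [exact: coord_dist_continuous|exact: Wc].
Qed.

Lemma row_norm_le (R : realType) (n : nat) (v : 'rV[R]_n) (r : R) :
  0 <= r -> (forall i, `|v ord0 i| <= r) -> `|v| <= r.
Proof.
move=> r0 vr; rewrite [leLHS]/Num.Def.normr/= mx_normrE; apply/bigmax_leP; split=> //.
by move=> [i j] _; rewrite (ord1 i).
Qed.

Lemma coord_le_norm (R : realType) (n : nat) (v : 'rV[R]_n) (i : 'I_n) :
  `|v ord0 i| <= `|v|.
Proof.
rewrite [leRHS]/Num.Def.normr/= mx_normrE; apply/bigmax_geP; right.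
by exists (ord0, i).
Qed.

Lemma anchored_box_compact (R : realType) (n : nat) (u : 'rV[R]_n.+1) :
  anchored u -> compact (anchored_box u).
Proof.
move=> uanch; apply: bounded_closed_compact.
  exists (`|u| + 1); split; first exact: num_real.
  move=> r ur v [vanch vbox]; apply: le_trans (ltW ur).
  rewrite -[v](subrK u) addrC; apply: le_trans (ler_normD _ _) _.
  rewrite lerD2l; apply: row_norm_le => // i; rewrite !mxE ler_norml.
  have := vbox i ord0; have := vbox ord0 i.
  rewrite (vanch ord0)// (uanch ord0)//; lra.
rewrite (_ : anchored_box u =
   [set v : 'rV[R]_n.+1 | v ord0 ord0 = 0] `&`
   \bigcap_(ij in setT) [set v | v ord0 ij.1 - v ord0 ij.2
      <= 1 + (u ord0 ij.1 - u ord0 ij.2)]).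
  apply: closedI.
    have /continuous_closedP/(_ _ (@closed_eq R 0)) :=
      @coord_continuous R 1 n.+1 ord0 ord0; exact.
  apply: closed_bigI => -[i j] _ /=.
  have /continuous_closedP/(_ _ (@closed_le R _)) :=
    @coord_dist_continuous R n.+1 i j; exact.
apply/seteqP; split=> v [].
  move=> vanch vbox; split; first exact: vanch.
  by move=> [i j] _ /=; have := vbox i j; lra.
move=> v0 vbox; split=> [i i0|i j].
  by have -> : i = ord0 by exact/val_inj.
by have := vbox (i, j) I; rewrite /=; lra.
Qed.

(** Both tangents are taken at the intermediate point, where the weighted first-order terms
    cancel. *)
Lemma pair_objective_concave (R : realType) (n : nat)
    (W G : 'I_n -> 'I_n -> R -> R) (v v' : 'rV[R]_n) (s : R) :
  0 <= s -> s <= 1 ->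
  (forall i j y z, i != j -> W i j z <= W i j y + G i j y * (z - y)) ->
  (1 - s) * pair_objective W v + s * pair_objective W v'
    <= pair_objective W (v + s *: (v' - v)).
Proof.
move=> s0 s1 tan; rewrite !mulr_sumr -big_split; apply: ler_sum => i _ /=.
rewrite !mulr_sumr -big_split; apply: ler_sum => j ij /=.
set w := v + _; set y := w ord0 i - w ord0 j.
have := tan i j y (v ord0 i - v ord0 j) ij.
have := tan i j y (v' ord0 i - v' ord0 j) ij.
have : (1 - s) * (v ord0 i - v ord0 j - y) + s * (v' ord0 i - v' ord0 j - y) = 0.
  by rewrite /y /w !mxE; ring.
set y1 := _ - y; set y2 := _ - y => y0 h1 h2.
have h3 : s * (W i j y + G i j y * y2 - W i j (v' ord0 i - v' ord0 j)) >= 0.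
  by rewrite mulr_ge0// subr_ge0.
have h4 : (1 - s) * (W i j y + G i j y * y1 - W i j (v ord0 i - v ord0 j)) >= 0.
  by rewrite mulr_ge0// subr_ge0.
have : G i j y * ((1 - s) * y1 + s * y2) = 0 by rewrite y0 mulr0.
by lra.
Qed.

Lemma pair_objective_strict (R : realType) (n : nat)
    (W G : 'I_n -> 'I_n -> R -> R) (v v' : 'rV[R]_n) (i j : 'I_n) :
  (forall i j y z, i != j -> W i j z <= W i j y + G i j y * (z - y)) ->
  (forall y z, z != y -> W i j z < W i j y + G i j y * (z - y)) ->
  i != j -> v ord0 i - v ord0 j != v' ord0 i - v' ord0 j ->
  pair_objective W v + pair_objective W v'
    < 2 * pair_objective W (v + 2^-1 *: (v' - v)).
Proof.
move=> tan stan ij vv'; set w := v + _.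
pose D k l := 2 * W k l (w ord0 k - w ord0 l) - W k l (v ord0 k - v ord0 l)
  - W k l (v' ord0 k - v' ord0 l).
have mid k l : (v ord0 k - v ord0 l - (w ord0 k - w ord0 l)) +
    (v' ord0 k - v' ord0 l - (w ord0 k - w ord0 l)) = 0.
  by rewrite /w !mxE; field.
have D0 k l : k != l -> 0 <= D k l.
  move=> kl; rewrite /D; set y := w ord0 k - w ord0 l.
  have := tan k l y (v ord0 k - v ord0 l) kl.
  have := tan k l y (v' ord0 k - v' ord0 l) kl.
  have := mid k l; rewrite -/y; set y1 := _ - y; set y2 := _ - y => y0.
  have : G k l y * (y1 + y2) = 0 by rewrite y0 mulr0.
  by lra.
have Dij : 0 < D i j.
  rewrite /D; set y := w ord0 i - w ord0 j.
  have := mid i j; rewrite -/y => m0.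
  have y1 : v ord0 i - v ord0 j != y by apply: contra_neq vv'; lra.
  have y2 : v' ord0 i - v' ord0 j != y by apply: contra_neq vv'; lra.
  have := stan _ _ y1; have := stan _ _ y2.
  move: m0; set z1 := _ - y; set z2 := _ - y => y0.
  have : G i j y * (z1 + z2) = 0 by rewrite y0 mulr0.
  by lra.
rewrite -subr_gt0.
have -> : 2 * pair_objective W w - (pair_objective W v + pair_objective W v') =
    \sum_k \sum_(l | k != l) D k l.
  rewrite opprD addrA mulr_sumr -!sumrB; apply: eq_bigr => k _.
  by rewrite mulr_sumr -!sumrB.
rewrite (bigD1 i)//= (bigD1 j)//= -addrA ltr_pwDl// addr_ge0//.
  by apply: sumr_ge0 => k /andP[? _]; exact: D0.
by apply: sumr_ge0 => k _; apply: sumr_ge0 => l; exact: D0.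
Qed.

(** The deterministic core. The condition [2 * l%:R * eta < 1] leaves slack in the spread constraint
    at the maximiser over the box, which makes it global. Uniqueness rests on the lower bound for
    cut weights, which prevents the compared pairs from leaving the items disconnected. *)
Lemma maximizer_near_center (R : realType) (n : nat)
    (W G : 'I_n.+1 -> 'I_n.+1 -> R -> R)
    (a : 'I_n.+1 -> 'I_n.+1 -> R) (u : 'rV[R]_n.+1) (M sigma m D eta : R)
    (l : nat) :
  (forall i j, 0 <= a i j) -> (forall i j, i != j -> a i j = a j i) ->
  0 < sigma -> 0 < m -> 0 < D -> 0 < eta ->
  (forall i j, i != j -> continuous (W i j)) ->
  (forall i j y, i != j -> G i j y = - G j i (- y)) ->
  (forall i j y z, i != j -> W i j z <= W i j y + G i j y * (z - y)) ->
  (forall i j y z, i != j -> 0 < a i j -> z != y ->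
     W i j z < W i j y + G i j y * (z - y)) ->
  (forall i j y z, i != j -> - (M + 1) <= y -> y <= z -> z <= M + 1 ->
     G i j z - G i j y <= - (sigma * a i j * (z - y))) ->
  anchored u -> (forall i j, `|u ord0 i - u ord0 j| <= M) ->
  (forall S : {set 'I_n.+1}, S != finset.set0 -> (2 * #|S| <= n.+1)%N ->
     m * #|S|%:R <= \sum_(i in S) \sum_(j in ~: S) a i j) ->
  (forall j, \sum_(i | i != j) a i j <= D * m) ->
  (forall S : {set 'I_n.+1}, S != finset.set0 -> (2 * #|S| <= n.+1)%N ->
     `|\sum_(i in S) \sum_(j in ~: S) G i j (u ord0 i - u ord0 j)|
       <= sigma * (eta / 2 * m * #|S|%:R)) ->
  n.+1%:R < (1 + (2 * D)^-1) ^+ l -> 2 * l%:R * eta < 1 ->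
  exists v, [/\ anchored v,
    forall v', anchored v' -> pair_objective W v' <= pair_objective W v,
    forall v', anchored v' -> pair_objective W v <= pair_objective W v' -> v = v'
    & forall i j, (v ord0 i - u ord0 i) - (v ord0 j - u ord0 j) <= 2 * l%:R * eta].
Proof.
move=> a0 asym sigma0 m0 D0 eta0 Wc GN tan stan slope uanch uM cut deg noise nl small.
have [||v /set_mem vK vmax] := @compact_EVT_max _ R (pair_objective W) (anchored_box u) _
    (anchored_box_compact uanch).
- by exists u; split=> // i j; rewrite !subrr ler01.
- exact/continuous_subspaceT/pair_objective_continuous.
have {}vmax v' : anchored_box u v' -> pair_objective W v' <= pair_objective W v.
  by move=> ?; apply: vmax; rewrite inE.
have [vanch vbox] := vK.
have drop := cut_drop a0 sigma0 GN tan slope uM vK vmax.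
have spread i j : (v ord0 i - u ord0 i) - (v ord0 j - u ord0 j) <= 2 * l%:R * eta.
  apply: (@spread_bound _ _ a (fun i => v ord0 i - u ord0 i) m D eta l) => //.
  - move=> t S S0 Sn; rewrite -(ler_pM2l sigma0).
    apply: le_trans (le_trans (ler_norm _) (noise S S0 Sn)).
    apply: drop => i' j'; rewrite !inE -ltNge => h1 h2; exact: lt_le_trans h1.
  (* A lower level set is handled through its complement, an upper set; exchanging the two sides
     flips the sign of the noise and leaves the drop unchanged. *)
  - move=> t S S0 Sn; rewrite -(ler_pM2l sigma0).
    apply: le_trans (noise S S0 Sn); rewrite -normrN.
    apply: le_trans (ler_norm _).
    have -> : - (\sum_(i in S) \sum_(j in ~: S) G i j (u ord0 i - u ord0 j)) =
        \sum_(i in ~: S) \sum_(j in ~: ~: S) G i j (u ord0 i - u ord0 j).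
      rewrite finset.setCK exchange_big/= -sumrN; apply: eq_bigr => j' j'S.
      rewrite -sumrN; apply: eq_bigr => i' i'S; rewrite GN ?opprB ?opprK//.
      by apply: contraTN j'S => /eqP <-; rewrite inE i'S.
    rewrite [X in sigma * X](_ : _ = \sum_(i in ~: S) \sum_(j in ~: ~: S)
        a i j * ((v ord0 i - u ord0 i) - (v ord0 j - u ord0 j))).
      apply: drop => i' j'; rewrite !inE negbK -ltNge => h1 h2.
      exact: le_lt_trans h1.
    rewrite finset.setCK exchange_big/=; apply: eq_bigr => j' j'S.
    apply: eq_bigr => i' i'S; rewrite asym//.
    by apply: contraTN j'S => /eqP <-; rewrite inE i'S.
(* A short step from [v] towards a better [v'] stays in the box, because the slack [e] absorbs the
   change [s * b] of any difference; by concavity that step would already be an improvement. *)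
have glob v' : anchored v' -> pair_objective W v' <= pair_objective W v.
  move=> v'anch; rewrite leNgt; apply/negP => hlt.
  set e := 1 - 2 * l%:R * eta; have e0 : 0 < e by rewrite /e; lra.
  set b := 2 * `|v' - v|; have b0 : 0 <= b by rewrite mulr_ge0.
  pose s := Num.min 1 (e / (b + 1)).
  have s0 : 0 < s by rewrite lt_min ltr01 divr_gt0// ltr_wpDl.
  have s1 : s <= 1 by rewrite ge_min lexx.
  have sb : s * b <= e.
    apply: (@le_trans _ _ (e / (b + 1) * b)).
      by rewrite ler_wpM2r// ge_min lexx orbT.
    by rewrite mulrAC ler_pdivrMr ?ltr_wpDl// ler_wpM2l ?lerDl// ltW.
  have := @pair_objective_concave _ _ W G v v' s (ltW s0) s1 tan.
  have : pair_objective W (v + s *: (v' - v)) <= pair_objective W v.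
    apply: vmax; split=> [i i0|i j].
      by rewrite !mxE vanch// v'anch// subrr mulr0 addr0.
    have := coord_le_norm (v' - v) i; have := coord_le_norm (v' - v) j.
    have := spread i j; rewrite !mxE /= !ler_norml => h1 /andP[h2 h3] /andP[h4 h5].
    apply: (@le_trans _ _ (2 * l%:R * eta + s * b)); last first.
      by move: sb; rewrite /e; lra.
    have : s * ((v' ord0 i - v ord0 i) - (v' ord0 j - v ord0 j)) <= s * b.
      by rewrite ler_pM2l// /b; lra.
    by lra.
  by nra.
exists v; split=> // v' v'anch vv'; apply/eqP/negPn/negP => vv'N.
(* Two distinct maximisers agree on [U], which contains item 0 but not all items. The smaller of [U]
   and its complement has a compared pair across its cut; the differences of [v] and [v'] disagree
   on that pair, so the midpoint would be strictly better. *)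
pose U := [set i | v' ord0 i == v ord0 i]%SET.
have U0 : U != finset.set0.
  by apply/set0Pn; exists ord0; rewrite inE vanch// v'anch.
have UC0 : (~: U)%SET != finset.set0.
  apply: contra vv'N => /eqP UC; apply/eqP/rowP => i.
  have : i \in U by rewrite -[U]finset.setCK UC inE inE.
  by rewrite inE => /eqP ->.
have edge (S : {set 'I_n.+1}) : S != finset.set0 -> (2 * #|S| <= n.+1)%N ->
    exists i j, [/\ i \in S, j \notin S & 0 < a i j].
  move=> S0 Sn; apply: contrapT => noedge; have := cut S S0 Sn.
  rewrite big1 => [|i iS].
    by rewrite leNgt mulr_gt0// ltr0n card_gt0.
  rewrite big1// => j; rewrite inE => jS; apply/eqP.
  rewrite eq_le a0 andbT leNgt; apply/negP => aij; apply: noedge.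
  by exists i, j.
have [i [j [ij aij vij]]] : exists i j, [/\ i != j, 0 < a i j &
    v ord0 i - v ord0 j != v' ord0 i - v' ord0 j].
  have cross i j : i \in U -> j \notin U ->
      (i != j) /\ (v ord0 i - v ord0 j != v' ord0 i - v' ord0 j).
    move=> iU jU; split; first by apply: contra jU => /eqP <-.
    move: iU jU; rewrite !inE => /eqP ->; apply: contra => /eqP; lra.
  have [Un|Un] := leqP (2 * #|U|) n.+1.
    have [i [j [iU jU aij]]] := edge U U0 Un; exists i, j.
    by have [? ?] := cross _ _ iU jU.
  have [|i [j [iU jU aij]]] := edge _ UC0.
    rewrite -(leq_add2l (2 * #|U|)) -mulnDr cardsC card_ord mul2n -addnn.
    by rewrite leq_add2r ltnW.
  exists j, i; rewrite !inE negbK in iU jU.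
  have [||? ?] := cross j i; rewrite ?inE//.
  by split=> //; rewrite asym.
have := pair_objective_strict tan (fun y z => @stan i j y z ij aij) ij vij.
have := glob (v + 2^-1 *: (v' - v)).
rewrite ltNge => /(_ _) h /negP; apply.
have : pair_objective W (v + 2^-1 *: (v' - v)) <= pair_objective W v.
  by apply: h => k k0; rewrite !mxE vanch// v'anch// subrr mulr0 addr0.
by lra.
Qed.

(** * Expectations of products of independent variables *)

Section density.
Import HBNNSimple.
Local Open Scope ereal_scope.

(** The identity extends from indicators to simple functions and monotone limits. With [Z] one
    variable and [phi] a product of functions of others it factorises expectations; with [Z] the
    identity it integrates against a density on the line. *)
Lemma ge0_integral_density (d1 d2 : measure_display) (T1 : measurableType d1)
    (T2 : measurableType d2) (R : realType) (mu : {measure set T1 -> \bar R})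
    (nu : {measure set T2 -> \bar R}) (Z : T1 -> T2) (phi : T1 -> R)
    (h : T2 -> \bar R) :
  measurable_fun [set: T1] Z -> measurable_fun [set: T1] phi ->
  (forall x, (0 <= phi x)%R) -> measurable_fun [set: T2] h -> (forall y, 0 <= h y) ->
  (forall B, measurable B ->
     nu B = \int[mu]_x (phi x * \1_(Z @^-1` B) x)%:E) ->
  \int[nu]_y h y = \int[mu]_x ((phi x)%:E * h (Z x)).
Proof.
move=> mZ mphi phi0 mh h0 nuE.
pose g := nnsfun_approx measurableT mh.
have mg n : measurable_fun [set: T2] (g n : T2 -> R) by exact/measurable_funP.
have gh y : (g n y)%:E @[n --> \oo] --> h y.
  by apply: (@cvg_nnsfun_approx _ _ _ _ measurableT) => // y' _; exact: h0.
have -> : \int[nu]_y h y = lim (\int[nu]_y (g n y)%:E @[n --> \oo]).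
  rewrite -monotone_convergence//=.
  - by apply: eq_integral => y _; apply/esym/cvg_lim.
  - by move=> n; exact/measurable_EFinP.
  - by move=> n y _; rewrite lee_fin.
  - by move=> y _ a b ab; rewrite lee_fin; exact/lefP/nd_nnsfun_approx.
have -> : \int[mu]_x ((phi x)%:E * h (Z x)) =
    lim (\int[mu]_x ((phi x)%:E * (g n (Z x))%:E) @[n --> \oo]).
  rewrite -monotone_convergence//=.
  - by apply: eq_integral => x _; apply/esym/cvg_lim => //; exact: cvgeZl.
  - move=> n; apply: emeasurable_funM; first exact/measurable_EFinP.
    by apply/measurable_EFinP; exact: measurableT_comp.
  - by move=> n x _; rewrite mule_ge0 ?lee_fin.
  - move=> x _ a b ab; rewrite lee_wpmul2l ?lee_fin//.
    exact/lefP/nd_nnsfun_approx.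
congr (limn _); apply/funext => n /=.
pose k r := g n @^-1` [set r].
have mk r : measurable (k r) by rewrite -[k r]setTI; exact: mg.
transitivity (\int[nu]_y (\sum_(r \in range (g n)) (r * \1_(k r) y)%:E)).
  by apply: eq_integral => y _; rewrite fimfunE -fsumEFin.
rewrite ge0_integral_fsum//; last 2 first.
- by move=> r; apply/measurable_EFinP; exact: measurable_funM.
- by move=> r y _; exact: nnfun_muleindic_ge0.
transitivity (\int[mu]_x (\sum_(r \in range (g n))
    (phi x * (r * \1_(k r) (Z x)))%:E)); last first.
  apply: eq_integral => x _; rewrite fimfunE -fsumEFin//.
  rewrite ge0_mule_fsumr// => r; exact: nnfun_muleindic_ge0.
have m1 r : measurable_fun [set: T1] (fun x => \1_(k r) (Z x) : R).
  by apply: measurableT_comp => //; exact: measurable_indic.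
rewrite ge0_integral_fsum//; last 2 first.
- move=> r; apply/measurable_EFinP; apply: measurable_funM => //.
  exact: measurable_funM.
- move=> r x _; rewrite EFinM mule_ge0 ?lee_fin//.
  by have := nnfun_muleindic_ge0 (g n) r (Z x); rewrite lee_fin.
apply: eq_fsbigr => r /[!inE] -[y _ <-{r}].
have r0 : (0 <= g n y)%R by [].
move: (g n y) r0 => r r0.
under eq_integral do rewrite EFinM.
rewrite ge0_integralZl//; last first.
- by apply/measurable_EFinP; exact: measurable_indic.
rewrite integral_indic// setIT nuE//.
under [RHS]eq_integral => x _ do rewrite mulrCA EFinM.
rewrite ge0_integralZl//.
- by apply/measurable_EFinP; apply: measurable_funM.
- by move=> x _; rewrite lee_fin mulr_ge0.
Qed.

End density.

Lemma cond_prob_probability (R : realType) (d : measure_display)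
    (Omega : measurableType d) (P : probability Omega R) (E : set Omega) :
  measurable E -> P E != 0%E ->
  exists Q : probability Omega R, (Q : set Omega -> \bar R) = cond_prob P E.
Proof.
move=> mE PE0; exists (mnormalize (mrestr P mE) P); apply/funext => F.
have PEfin : P E \is a fin_num by exact: fin_num_measure.
rewrite /= /mnormalize /= /mrestr /= setTI ifF; last first.
  by apply/negbTE; rewrite negb_or PE0/=; move: PEfin; rewrite fin_numE => /andP[].
by rewrite /cond_prob -[in RHS](fineK PEfin) inver ifF// fine_eq0// (negbTE PE0).
Qed.

(** Independence is given for events only, so functions are introduced one at a time while the
    indices in [K] carry an arbitrary event. This event is what lets the induction move a variable
    from the event side to the function side. *)
Lemma expectation_prod_indep_event (R : realType) (d d' : measure_display)
    (Omega : measurableType d) (S : measurableType d') (P : probability Omega R)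
    (I : finType) (D : {set I}) (Y : I -> {RV P >-> S}) (h : I -> S -> R)
    (e : I -> R) (s : seq I) :
  mutually_independent P D (fun i => Y i) ->
  (forall i, measurable_fun [set: S] (h i)) ->
  (forall i y, 0 <= h i y) ->
  (forall i, i \in D -> (\int[P]_w (h i (Y i w))%:E = (e i)%:E)%E) ->
  uniq s -> {subset s <= D} ->
  forall (K : {set I}) (B : I -> set S), K \subset D ->
  (forall i, i \in s -> i \notin K) -> (forall i, measurable (B i)) ->
  (\int[P]_w (\prod_(i <- s) h i (Y i w) *
     \1_(\bigcap_(i in [set` K]) Y i @^-1` B i) w)%:E =
   (\prod_(i <- s) e i)%:E * P (\bigcap_(i in [set` K]) Y i @^-1` B i))%E.
Proof.
move=> indep mh h0 eE; elim: s => [|j s IH] /=.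
  move=> _ _ K B KD _ mB.
  under eq_integral do rewrite big_nil mul1r.
  rewrite integral_indic ?setIT ?big_nil ?mul1e//.
  by apply: fin_bigcap_measurable => // i _;
    rewrite -[X in measurable X]setTI; exact: measurable_funPT.
move=> /andP[js us] sD K B KD sK mB.
have jD : j \in D by apply: sD; rewrite mem_head.
have sD' : {subset s <= D} by move=> i si; apply: sD; rewrite inE si orbT.
have jK : j \notin K by apply: sK; rewrite mem_head.
set C := \bigcap_(i in _) _.
have mC : measurable C.
  by apply: fin_bigcap_measurable => // i _;
    rewrite -[X in measurable X]setTI; exact: measurable_funPT.
pose phi w := \prod_(i <- s) h i (Y i w) * \1_C w.
have h0w : forall r w, 0 <= \prod_(i <- r) h i (Y i w) by move=> r w; exact: prodr_ge0.
have phi0 w : 0 <= phi w by rewrite mulr_ge0.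
have e0 i : i \in D -> 0 <= e i.
  by move=> iD; rewrite -lee_fin -eE// integral_ge0// => w _; rewrite lee_fin.
have c0 : 0 <= \prod_(i <- s) e i * fine (P C).
  rewrite mulr_ge0 ?fine_ge0//.
  by rewrite big_seq; apply: prodr_ge0 => i /sD'; exact: e0.
have mphi : measurable_fun [set: Omega] phi.
  apply: measurable_funM; last exact: measurable_indic.
  apply: measurable_prod => i _.
  by apply: measurableT_comp => //; exact: measurable_funPT.
have PCfin : P C \is a fin_num by exact: fin_num_measure.
(* Applied with [j] added to [K], the induction hypothesis says that the law of [Y j] weighted by
   [phi] is a constant multiple of its own law; [nu] is that multiple. *)
pose nu := mscale (NngNum c0) (distribution P (Y j)).
have nuE A : measurable A ->
    (nu A = \int[P]_w (phi w * \1_(Y j @^-1` A) w)%:E)%E.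
  move=> mA; pose B' i := if i == j then A else B i.
  have := IH us sD' (j |: K)%SET B'.
  have KE : \bigcap_(i in [set` (j |: K)%SET]) Y i @^-1` B' i = C `&` Y j @^-1` A.
    apply/seteqP; split=> w.
      move=> wK; split; last by have := wK j; rewrite /= finset.setU11 /B' eqxx; exact.
      move=> i /= iK; have := wK i; rewrite /= inE iK orbT /B'.
      by case: eqVneq => [ij|_]; [move: jK; rewrite -ij iK|exact].
    move=> [wC wA] i /=; rewrite /B' !inE; case: eqVneq => [->//|_ /=].
    exact: wC.
  rewrite KE => IH'.
  have IndA : (P (C `&` Y j @^-1` A) = P C * P (Y j @^-1` A))%E.
    rewrite -KE indep//; last 2 first.
    - by rewrite finset.subUset finset.sub1set jD.
    - by move=> i; rewrite /B'; case: ifP.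
    rewrite big_setU1//= /B' eqxx muleC; congr (_ * _)%E.
    rewrite /C indep//; apply: eq_bigr => i iK; rewrite ifN//.
    by apply: contraNneq jK => <-.
  have {IH'} := IH' _ _ _.
  rewrite IndA => IH'.
  rewrite /nu /mscale/= EFinM fineK// -muleA -IH'; last 3 first.
  - by rewrite finset.subUset finset.sub1set jD.
  - move=> i si; rewrite !inE negb_or sK ?inE ?si ?orbT// andbT.
    by apply: contraNneq js => <-.
  - by move=> i; rewrite /B'; case: ifP.
  by apply: eq_integral => w _; rewrite indicI /phi mulrA.
have := @ge0_integral_density _ _ _ _ _ P nu (Y j) phi (EFin \o h j)
  (measurable_funPT _) mphi phi0 _ _ nuE.
rewrite ge0_integral_mscale//; last 2 first.
- exact/measurable_EFinP.
- by move=> y _; rewrite lee_fin.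
rewrite ge0_integral_distribution//; last 2 first.
- exact/measurable_EFinP.
- by move=> y; rewrite lee_fin.
rewrite /= eE// => H; under eq_integral do rewrite big_cons.
rewrite big_cons -[P C]fineK// -EFinM.
transitivity (\int[P]_w ((phi w)%:E * (h j (Y j w))%:E))%E.
  by apply: eq_integral => w _; rewrite -EFinM /phi; congr EFin; ring.
rewrite -H; first by rewrite -EFinM; congr EFin; ring.
- exact/measurable_EFinP.
- by move=> y; rewrite lee_fin.
Qed.

Lemma expectation_prod_indep (R : realType) (d d' : measure_display)
    (Omega : measurableType d) (S : measurableType d') (P : probability Omega R)
    (I : finType) (D : {set I}) (Y : I -> {RV P >-> S}) (h : I -> S -> R)
    (e : I -> R) :
  mutually_independent P D (fun i => Y i) ->
  (forall i, measurable_fun [set: S] (h i)) ->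
  (forall i y, 0 <= h i y) ->
  (forall i, i \in D -> (\int[P]_w (h i (Y i w))%:E = (e i)%:E)%E) ->
  (\int[P]_w (\prod_(i in D) h i (Y i w))%:E = (\prod_(i in D) e i)%:E)%E.
Proof.
move=> indep mh h0 eE.
have := @expectation_prod_indep_event _ _ _ _ _ P I D Y h e (enum D) indep mh
  h0 eE (enum_uniq D) _ finset.set0 (fun=> setT) (finset.sub0set _) _ _.
have -> : \bigcap_(i in [set` finset.set0]) (Y i @^-1` setT) = [set: Omega].
  by rewrite -subTset => w _ i _.
rewrite probability_setT mule1 -big_enum => <-//.
- by apply: eq_integral => w _; rewrite indicT mulr1 big_enum.
- by move=> i; rewrite mem_enum.
- by move=> i _; rewrite inE.
Qed.

Lemma expR_le_quadratic (R : realType) (s : R) :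
  `|s| <= 2^-1 -> expR s <= 1 + s + 2 * s ^+ 2.
Proof.
rewrite ler_norml => /andP[s1 s2].
have h : 0 < 1 - s by lra.
have : expR s <= (1 - s)^-1.
  rewrite -[leLHS]invrK -expRN lef_pV2 ?posrE ?expR_gt0//.
  exact: expR_ge1Dx.
move=> /le_trans; apply; rewrite -[leLHS]mul1r ler_pdivrMr//.
(* The product of 1 - s and 1 + s + 2 s^2 is 1 + s^2 (1 - 2 s), which is at least 1. *)
have : 0 <= s ^+ 2 * (1 - 2 * s) by rewrite mulr_ge0 ?sqr_ge0//; lra.
by rewrite expr2; lra.
Qed.

Lemma chernoff_bound (R : realType) (d : measure_display)
    (Omega : measurableType d) (P : probability Omega R) (Z : Omega -> R)
    (a b : R) :
  measurable_fun [set: Omega] Z ->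
  (\int[P]_w (expR (Z w))%:E <= (expR b)%:E)%E ->
  (P [set w | (a <= Z w)%R] <= (expR (b - a))%:E)%E.
Proof.
move=> mZ Zb.
have mA : measurable [set w | a <= Z w].
  rewrite -[X in measurable X]setTI.
  exact: (measurable_fun_le measurableT (measurable_cst a) mZ).
have mexpZ : measurable_fun [set: Omega] (fun w => expR (Z w)).
  by apply: measurableT_comp.
apply: (@le_trans _ _ (\int[P]_w ((expR (- a))%:E * (expR (Z w))%:E))%E).
  rewrite -[X in P X]setIT -integral_indic//.
  apply: ge0_le_integral => //.
  - by apply/measurable_EFinP; exact: measurable_indic.
  - by apply/measurable_EFinP; exact: measurable_funM.
  - move=> w _; rewrite -EFinM lee_fin -expRD addrC indicE.
    case: (boolP (w \in _)) => [/[!inE]/= aw|_]; last exact: expR_ge0.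
    by rewrite -expR0 ler_expR subr_ge0.
rewrite ge0_integralZl//; last exact/measurable_EFinP.
rewrite addrC expRD EFinM lee_pmul2l// ?fin_numE// lte_fin expR_gt0//.
Qed.

Lemma bounded_affine_expectation (R : realType) (d : measure_display)
    (Omega : measurableType d) (Q : probability Omega R) (Z : Omega -> R)
    (b : R) :
  measurable_fun [set: Omega] Z -> (forall w, `|Z w| <= b) ->
  exists m, forall a c, (\int[Q]_w (a + c * Z w)%:E = (a + c * m)%:E)%E.
Proof.
move=> mZ Zb.
have iZ : Q.-integrable [set: Omega] (EFin \o Z).
  apply: measurable_bounded_integrable => //.
    by rewrite (le_lt_trans (probability_le1 _ _))// ltry.
  by exists b; split; [exact: num_real|move=> r br w _; exact: le_trans (Zb w) (ltW br)].
exists (fine (\int[Q]_w (Z w)%:E)) => a c.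
under eq_integral do rewrite EFinD.
rewrite integralD//; last 2 first.
- exact: (finite_measure_integrable_cst Q a measurableT).
- have -> : (fun w => (c * Z w)%:E) = (fun w => (c%:E * (EFin \o Z) w)%E) by [].
  exact: integrableZl.
rewrite integral_cst// [X in (_ * X)%E](_ : _ = 1%E); last exact: probability_setT.
rewrite mule1 EFinD; congr (_ + _)%E.
under eq_integral do rewrite EFinM.
rewrite integralZl// EFinM fineK//; exact: integrable_fin_num.
Qed.

Lemma binomial_mgf (R : realType) (d : measure_display)
    (Omega : measurableType d) (P : probability Omega R) (T : nat) (p : R)
    (N : {RV P >-> nat}) (s : R) :
  0 <= p <= 1 ->
  (forall B, P (N @^-1` B) = binomial_prob T p B) ->
  (\int[P]_w (expR (s * (N w)%:R))%:E = ((1 + p * (expR s - 1)) ^+ T)%:E)%E.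
Proof.
move=> /andP[p0 p1] NE.
have mh : measurable_fun [set: nat] (fun k : nat => (expR (s * k%:R))%:E) by [].
have h0 k : (0 <= (expR (s * k%:R))%:E)%E by rewrite lee_fin expR_ge0.
have := @ge0_integral_distribution _ _ _ _ _ P N (fun k => (expR (s * k%:R))%:E) mh h0.
rewrite /comp/= => <-.
rewrite (eq_measure_integral (binomial_prob T p)) => [|B _ _]; last exact: NE.
rewrite (@integral_binomial _ T p p0 p1)//.
rewrite sumEFin; congr EFin.
have -> : 1 + p * (expR s - 1) = (1 - p) + p * expR s by ring.
rewrite exprDn; apply: eq_bigr => k _ /=.
rewrite expRM_natr exprMn mulrnAl; congr (_ *+ _).
by rewrite mulrAC mulrC.
Qed.

(** * The score *)

Lemma mvt_derive1 (R : realType) (h : R -> R) (a b : R) :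
  (forall x, derivable h x 1) -> a < b ->
  exists c, [/\ a < c, c < b & h b - h a = h^`()%classic c * (b - a)].
Proof.
move=> dh ab.
have [||c] := @MVT R h h^`()%classic a b ab.
- by move=> x _; rewrite derive1E; exact: derivableP.
- apply: continuous_subspaceT => x.
  by apply: differentiable_continuous; exact/derivable1_diffP.
- by rewrite in_itv/= => /andP[ac cb] E; exists c.
Qed.

Lemma slope_le (R : realType) (h : R -> R) (lo hi k : R) :
  (forall x, derivable h x 1) ->
  (forall x, lo <= x -> x <= hi -> h^`()%classic x <= k) ->
  forall y z, lo <= y -> y <= z -> z <= hi -> h z - h y <= k * (z - y).
Proof.
move=> dh hk y z loy; rewrite le_eqVlt => /predU1P[<- _|yz zhi].
  by rewrite !subrr mulr0.
have [c [yc cz ->]] := mvt_derive1 dh yz.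
by rewrite ler_pM2r ?subr_gt0// hk//; [exact: le_trans (ltW yc)|exact: le_trans (ltW cz) _].
Qed.

Lemma strict_tangent (R : realType) (h : R -> R) :
  (forall x, derivable h x 1) -> (forall x, derivable h^`()%classic x 1) ->
  (forall x, (h^`()^`())%classic x < 0) ->
  forall y z, z != y -> h z < h y + h^`()%classic y * (z - y).
Proof.
move=> dh ddh h2 y z.
have decr a b : a < b -> h^`()%classic b < h^`()%classic a.
  move=> ab; have [c [_ _ E]] := mvt_derive1 ddh ab.
  by rewrite -subr_lt0 E pmulr_llt0 ?subr_gt0.
rewrite neq_lt => /orP[zy|yz].
  have [c [_ cy E]] := mvt_derive1 dh zy.
  have := decr _ _ cy; rewrite -(ltr_pM2r (x := y - z)) ?subr_gt0// -E; lra.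
have [c [yc _ E]] := mvt_derive1 dh yz.
have := decr _ _ yc; rewrite -(ltr_pM2r (x := z - y)) ?subr_gt0// -E; lra.
Qed.

Section score.
Context (R : realType) (kind : outcome_kind) (A : set R) (f : R -> R -> R).
Hypotheses (hA : outcome_set kind A) (hf : valid kind A f)
  (hfc : strictly_log_concave A f).

Lemma outcome_set_measurable : measurable A.
Proof.
case: hA => _; case: (kind) => // cA.
by apply: countable_measurable => // t; exact: measurable_set1.
Qed.

Lemma loglik_derivable x y : A x -> derivable (fun z => ln (f x z)) y 1.
Proof. by move=> Ax; have [] := hfc y Ax. Qed.

Lemma score_derivable x y : A x -> derivable (score f x) y 1.
Proof. by move=> Ax; have [] := hfc y Ax. Qed.

Lemma log_tangent_strict x y z : A x -> z != y ->
  ln (f x z) < ln (f x y) + score f x y * (z - y).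
Proof.
move=> Ax; apply: (@strict_tangent R (fun z => ln (f x z))) => t.
- exact: loglik_derivable.
- exact: score_derivable.
- by have [] := hfc t Ax.
Qed.

Lemma log_tangent x y z : A x ->
  ln (f x z) <= ln (f x y) + score f x y * (z - y).
Proof.
move=> Ax; have [->|zy] := eqVneq z y; first by rewrite subrr mulr0 addr0.
exact/ltW/log_tangent_strict.
Qed.

Lemma density_tangent x y z : A x ->
  f x z <= f x y * expR (score f x y * (z - y)).
Proof.
move=> Ax; have fz := valid_pos hf z Ax; have fy := valid_pos hf y Ax.
rewrite -[leLHS]lnK ?posrE// -[X in X * _]lnK ?posrE// -expRD ler_expR.
exact: log_tangent.
Qed.

Lemma scoreN x y : A x -> score f (- x) (- y) = - score f x y.
Proof.
move=> Ax; rewrite /score.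
have AN : A (- x) by case: hA => + _; exact.
have -> : (fun z => ln (f x z)) = (fun z => ln (f (- x) z)) \o (- (id : R -> R)).
  by apply/funext => z /=; rewrite (valid_sym hf).
have dN : derivable (- (id : R -> R)) y 1 by apply: derivableN; exact: derivable_id.
rewrite (@derive1_comp R (- (id : R -> R)) (fun z => ln (f (- x) z)) y dN); last first.
  exact: loglik_derivable.
by rewrite derive1N; [rewrite derive1_id mulrN1 opprK|exact: derivable_id].
Qed.

(** The score is a pointwise limit on [A] of difference quotients with increments 1 / (n + 1), each
    measurable in the outcome. *)
Lemma measurable_score y : measurable_fun A (fun x => score f x y).
Proof.
apply: (@measurable_fun_cvg _ _ _ _
  (fun (n : nat) x => n.+1%:R * (ln (f x (n.+1%:R^-1 + y)) - ln (f x y)))).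
  move=> n; apply: measurable_funM => //; apply: measurable_funB.
    by apply: measurableT_comp; [exact: measurable_ln|exact: (valid_meas hf)].
  by apply: measurableT_comp; [exact: measurable_ln|exact: (valid_meas hf)].
move=> x Ax; have := @loglik_derivable x y Ax; rewrite /derivable => hd.
have : (h^-1 *: (ln (f x (h *: 1 + y)) - ln (f x y)) @[h --> 0^'] -->
   score f x y)%classic.
  by rewrite /score derive1E.
move/cvgr_dnbhsP/(_ (fun n => n.+1%:R^-1)) => hc.
have {}hc := hc (conj (fun n => invr_neq0 (lt0r_neq0 (ltr0Sn R n))) cvg_harmonic).
apply: cvg_trans hc; apply: near_eq_cvg; apply: nearW => n /=.
by rewrite invrK /GRing.scale/= mulr1.
Qed.

(** An inequality is enough for the mean-zero argument, and it covers both kinds of outcomes. With a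
    Lebesgue density the expectation becomes an integral over the line; in the discrete case finite
    sets [X] of atoms suffice, and [h (Y w)] dominates their contributions because at most one atom
    occurs. *)
Lemma base_integral_le_expectation (d : measure_display)
    (Omega : measurableType d) (Q : probability Omega R) (Y : {RV Q >-> R})
    (y z : R) (h : R -> R) :
  has_density Q Y kind A (f ^~ y) -> measurable_fun [set: R] h ->
  (forall x, 0 <= h x) -> (forall x, A x -> f x z <= f x y * h x) ->
  (base_integral kind A (f ^~ z) <= \int[Q]_w (h (Y w))%:E)%E.
Proof.
move=> dY mh h0 fz; have mA := outcome_set_measurable.
have mhY : measurable_fun [set: Omega] (fun w => (h (Y w))%:E).
  by apply/measurable_EFinP; apply: measurableT_comp => //; exact: measurable_funPT.
have fpos x t : A x -> 0 <= f x t by move=> /(valid_pos hf t) /ltW.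
have dens B : measurable B -> Q (Y @^-1` B) = base_integral kind (A `&` B) (f ^~ y).
  exact: dY.
move: dens (valid_meas hf y) (valid_meas hf z); rewrite /base_integral.
case: (kind) => dens my mz.
  pose phi := (f ^~ y) \_ A.
  have phi0 x : 0 <= phi x.
    by rewrite /phi patchE; case: ifPn => // /[!inE] /fpos; exact.
  have mphi : measurable_fun [set: R] phi.
    by apply/(measurable_restrict _ mA measurableT); rewrite setTI.
  have mEh : measurable_fun [set: R] (EFin \o h) by exact/measurable_EFinP.
  have Eh0 t : (0 <= (EFin \o h) t)%E by rewrite lee_fin.
  have -> : (\int[Q]_w (h (Y w))%:E =
      \int[lebesgue_measure]_x ((phi x)%:E * (h x)%:E))%E.
    rewrite -[LHS](ge0_integral_distribution Y mEh Eh0).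
    apply: (@ge0_integral_density _ _ _ _ _ lebesgue_measure (distribution Q Y)
      id phi (EFin \o h) (@measurable_id _ _ _) mphi phi0 mEh Eh0) => B mB.
    rewrite [LHS](dens B mB) [LHS]integral_mkcond.
    apply: eq_integral => x _; rewrite preimage_id /phi !patchE indicE in_setI.
    by case: (x \in A); case: (x \in B); rewrite /= ?mulr1 ?mulr0 ?mul0r.
  rewrite integral_mkcond; apply: ge0_le_integral => //.
  - by move=> x _; rewrite patchE; case: ifPn => // /[!inE] Ax; rewrite lee_fin fpos.
  - rewrite restrict_EFin.
    by apply/measurable_EFinP/(measurable_restrict _ mA measurableT); rewrite setTI.
  - by apply: emeasurable_funM; exact/measurable_EFinP.
  - move=> x _; rewrite /phi !patchE; case: ifPn => [/[!inE] Ax|_].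
      by rewrite -EFinM lee_fin fz.
    by rewrite mul0e.
have mYx x : measurable (Y @^-1` [set x]).
  by rewrite -[X in measurable X]setTI; exact: measurable_funPT.
apply: ub_ereal_sup => _ [X [finX XA] <-].
apply: (@le_trans _ _ (\sum_(x \in X)
    \int[Q]_w ((h x)%:E * (\1_(Y @^-1` [set x]) w)%:E))%E).
  apply: lee_fsum => // x Xx; have Ax : A x by exact: XA.
  rewrite ge0_integralZl ?lee_fin//; last exact/measurable_EFinP/measurable_indic.
  rewrite integral_indic// ?setIT//.
  rewrite [X in (_ * X)%E](dens _ (measurable_set1 x)).
  rewrite (_ : A `&` [set x] = [set x]); last first.
    by apply/seteqP; split => [t []//|t /= ->].
  rewrite esum_set1; last by rewrite lee_fin fpos.
  by rewrite -EFinM lee_fin mulrC fz.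
have mI x : measurable_fun [set: Omega] (fun w => ((h x)%:E * (\1_(Y @^-1` [set x]) w)%:E)%E).
  by apply: emeasurable_funM => //; exact/measurable_EFinP/measurable_indic.
rewrite -ge0_integral_fsum//; last first.
  by move=> x w _; rewrite -EFinM lee_fin mulr_ge0.
apply: ge0_le_integral => //.
- by move=> w _; apply: fsume_ge0 => x _; rewrite -EFinM lee_fin mulr_ge0.
- exact: emeasurable_fsum.
- move=> w _; have [Xw|Xw] := boolP (Y w \in X).
    rewrite (fsbigD1 (Y w))//=; last by rewrite inE in Xw.
    rewrite fsbig1 ?adde0; last first.
      move=> x [_ /= xw]; rewrite indicE memNset ?mule0//= => E.
      by apply: xw.
    by rewrite indicE mem_set// mule1.
  rewrite fsbig1 ?lee_fin// => x Xx; rewrite indicE memNset ?mule0//= => E.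
  by move: Xw; rewrite notin_setE; apply; rewrite E.
Qed.

End score.

Lemma measurable_fun_sum (R : realType) (d : measure_display)
    (Omega : measurableType d) (I : finType) (Q : pred I) (h : I -> Omega -> R) :
  (forall i, measurable_fun [set: Omega] (h i)) ->
  measurable_fun [set: Omega] (fun w => \sum_(i | Q i) h i w).
Proof.
move=> mh.
rewrite (_ : (fun _ => _) = fun w => \sum_i if Q i then h i w else 0).
  by apply: measurable_sum => i; case: (Q i) => //; exact: measurable_cst.
by apply/funext => w; rewrite big_mkcond.
Qed.

Lemma measurable_fun_preimage (d d' : measure_display) (T1 : measurableType d)
    (T2 : measurableType d') (g : T1 -> T2) (B : set T2) :
  measurable_fun [set: T1] g -> measurable B -> measurable (g @^-1` B).
Proof. by move=> mg mB; rewrite -[X in measurable X]setTI; exact: mg. Qed.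

Lemma ae_eventW (R : realType) (d : measure_display) (Omega : measurableType d)
    (P : probability Omega R) (good : set Omega) (F V : set Omega) (b : \bar R) :
  {ae P, forall w, good w} -> measurable F -> measurable V ->
  F `&` good `<=` V -> (P V <= b)%E -> (P F <= b)%E.
Proof.
move=> [Z [mZ PZ goodZ]] mF mV FV; apply: le_trans.
apply: (@le_trans _ _ (P (Z `|` V))).
  apply: le_measure; rewrite ?inE//; first exact: measurableU.
  move=> w Fw; have [gw|gw] := pselect (good w); first by right; apply: FV.
  by left; exact: goodZ.
by apply: (le_trans (measureU2 _ mZ mV)); rewrite [X in (X + _)%E]PZ add0e.
Qed.

Section outcome.
Context (R : realType) (kind : outcome_kind) (A : set R) (f : R -> R -> R).
Hypotheses (hA : outcome_set kind A) (hf : valid kind A f)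
  (hfc : strictly_log_concave A f).

(** Outcomes lie in [A] only almost surely; extension by 0 makes the score measurable on the whole
    line and carries any bound on its absolute value over from [A]. *)
Definition score_on (y : R) : R -> R := (fun x => score f x y) \_ A.

Lemma measurable_score_on y : measurable_fun [set: R] (score_on y).
Proof.
apply/(measurable_restrict _ (outcome_set_measurable hA) measurableT).
by rewrite setTI; exact: (measurable_score hf hfc).
Qed.

Lemma score_onE x y : A x -> score_on y x = score f x y.
Proof. by move=> Ax; rewrite /score_on patchE mem_set. Qed.

(* The score has mean zero because concavity makes [expR (l * score)] at least
   the likelihood ratio of two probability densities, so its expectation is at
   least 1 for both signs of [l]; no differentiation under the integral. *)
Lemma outcome_mgf (d : measure_display) (Omega : measurableType d)
    (Q : probability Omega R) (Y : {RV Q >-> R}) (y B lam : R) :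
  has_density Q Y kind A (f ^~ y) -> 0 <= B ->
  (forall x, A x -> `|score f x y| <= B) -> `|lam| * B <= 2^-1 ->
  exists e : R, [/\ 0 <= e, e <= expR (2 * (lam * B) ^+ 2) &
    (\int[Q]_w (expR (lam * score_on y (Y w)))%:E = e%:E)%E].
Proof.
move=> dY B0 sB lamB.
have gB x : `|score_on y x| <= B.
  by rewrite /score_on patchE; case: ifPn => [/[!inE] /sB//|_]; rewrite normr0.
have mg : measurable_fun [set: Omega] (fun w => score_on y (Y w)).
  by apply: measurableT_comp; [exact: measurable_score_on|exact: measurable_funPT].
have [m mE] := bounded_affine_expectation Q mg (fun w => gB (Y w)).
have mexp l : measurable_fun [set: R] (fun x => expR (l * score_on y x)).
  apply: measurableT_comp; first exact: measurable_expR.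
  by apply: measurable_funM => //; exact: measurable_score_on.
have upper l : `|l| * B <= 2^-1 ->
    (\int[Q]_w (expR (l * score_on y (Y w)))%:E <=
      (1 + 2 * (l * B) ^+ 2 + l * m)%:E)%E.
  move=> lB; rewrite -mE; apply: ge0_le_integral => //.
  - apply/measurable_EFinP; apply: (measurableT_comp (mexp l)).
    exact: measurable_funPT.
  - by apply/measurable_EFinP; apply: measurable_funD => //; exact: measurable_funM.
  - move=> w _; rewrite lee_fin.
    have lg : `|l * score_on y (Y w)| <= `|l| * B by rewrite normrM ler_wpM2l.
    apply: (le_trans (expR_le_quadratic (le_trans lg lB))).
    rewrite addrAC lerD2r lerD2l ler_pM2l// -[leLHS]real_normK ?num_real//.
    by rewrite -[leRHS]real_normK ?num_real// lerXn2r ?nnegrE// [leRHS]normrM (ger0_norm B0).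
have lower l : (1 <= \int[Q]_w (expR (l * score_on y (Y w)))%:E)%E.
  rewrite -(valid_int hf (y + l)).
  apply: (@base_integral_le_expectation R kind A f hA hf _ _ _ Y y (y + l)
    (fun x => expR (l * score_on y x)) dY (mexp l)) => x; first exact: expR_ge0.
  move=> Ax; rewrite score_onE//; have := density_tangent hf hfc y (y + l) Ax.
  by rewrite addrAC subrr add0r mulrC [X in expR X]mulrC mulrC.
(* For nonzero m, the two bounds at l = - m t would give t m^2 (1 - 2 t B^2) <= 0. The chosen t
   ensures both |l| B <= 1/2, so that [upper] applies, and 2 t B^2 < 1, a contradiction. *)
have m0 : m = 0.
  apply: contrapT => /eqP m0.
  have q0 : 0 < 1 + `|m| * B + B ^+ 2.
    by rewrite -addrA ltr_pwDl// addr_ge0 ?sqr_ge0// mulr_ge0.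
  have [t t0 tE] : exists2 t : R, 0 < t & t * (2 * (1 + `|m| * B + B ^+ 2)) = 1.
    exists (2 * (1 + `|m| * B + B ^+ 2))^-1; first by rewrite invr_gt0 mulr_gt0.
    by rewrite mulVf// gt_eqF// mulr_gt0.
  have tB : 0 <= t * B ^+ 2 by rewrite mulr_ge0 ?sqr_ge0// ltW.
  have tm : 0 <= t * (`|m| * B) by rewrite !mulr_ge0// ltW.
  have lB : `|- (m * t)| * B <= 2^-1.
    by rewrite normrN normrM (gtr0_norm t0); lra.
  have := le_trans (lower _) (upper _ lB); rewrite lee_fin.
  have m2 : 0 < m ^+ 2 by rewrite lt_def sqr_ge0 sqrf_eq0 m0.
  have : 0 < t * m ^+ 2 * (1 - 2 * (t * B ^+ 2)).
    rewrite mulr_gt0//; first by rewrite mulr_gt0.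
    by lra.
  by rewrite !exprMn !sqrrN !exprMn; lra.
have := upper lam lamB; rewrite m0 mulr0 addr0 => up.
have fin : (\int[Q]_w (expR (lam * score_on y (Y w)))%:E)%E \is a fin_num.
  rewrite ge0_fin_numE; first exact: le_lt_trans up (ltry _).
  by apply: integral_ge0 => w _; rewrite lee_fin expR_ge0.
exists (fine (\int[Q]_w (expR (lam * score_on y (Y w)))%:E)%E).
rewrite fineK//; split=> //.
- by rewrite fine_ge0// integral_ge0// => w _; rewrite lee_fin expR_ge0.
- rewrite -lee_fin fineK//; apply: (le_trans up); rewrite lee_fin.
  exact: expR_ge1Dx.
Qed.

End outcome.

(** * Tail bounds in the sampling model *)

Lemma mutually_independentS (R : realType) (d d' : measure_display)
    (Omega : measurableType d) (S : measurableType d') (Q : set Omega -> \bar R)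
    (I : finType) (D D' : {set I}) (Y : I -> Omega -> S) :
  D' \subset D -> mutually_independent Q D Y -> mutually_independent Q D' Y.
Proof.
by move=> DD' indep J B JD'; apply: indep; exact: fintype.subset_trans DD'.
Qed.

Section model.
Context (R : realType) (kind : outcome_kind) (A : set R) (f : R -> R -> R)
  (T : nat) (d : measure_display) (Omega : measurableType d)
  (P : probability Omega R) (n : nat) (u : 'rV[R]_n) (p : 'I_n -> 'I_n -> R)
  (N : 'I_n -> 'I_n -> {RV P >-> nat}) (X : 'I_n -> 'I_n -> nat -> {RV P >-> R}).
Hypotheses (hA : outcome_set kind A) (hf : valid kind A f)
  (hfc : strictly_log_concave A f)
  (hmodel : sampling_model kind A f T u p N X).

(** The inequality 1 + z <= e^z replaces the binomial moment generating function by a Poisson one.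
    Both tails are covered: s = -1 serves the lower bound on cuts, s = 1 the upper bound on
    degrees. *)
Lemma count_tail (J : {set 'I_n * 'I_n}) (s a : R) :
  (forall ij, ij \in J -> (ij.1 < ij.2)%N) ->
  (P [set w | (a <= s * \sum_(ij in J) (N ij.1 ij.2 w)%:R)%R] <=
   (expR (T%:R * (expR s - 1) * (\sum_(ij in J) p ij.1 ij.2) - a))%:E)%E.
Proof.
move=> Jlt.
have mN ij : measurable_fun [set: Omega] (fun w => (N ij.1 ij.2 w)%:R : R).
  by apply: (@measurableT_comp _ _ _ _ _ _ (fun k : nat => k%:R : R)).
apply: chernoff_bound.
  by apply: measurable_funM => //; apply: measurable_fun_sum => ij; exact: mN.
have p01 ij : ij \in J -> 0 <= p ij.1 ij.2 <= 1.
  move=> /Jlt lt; have := rate_range hmodel (i := ij.1) (j := ij.2).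
  by rewrite -val_eqE/= ltn_eqF// => /(_ isT) /andP[/ltW -> ->].
have indep : mutually_independent P J (fun ij => N ij.1 ij.2).
  apply: mutually_independentS (count_indep hmodel).
  by apply/fintype.subsetP => ij /Jlt; rewrite inE.
have := @expectation_prod_indep _ _ _ _ _ P _ J (fun ij => N ij.1 ij.2)
  (fun _ k => expR (s * k%:R)) (fun ij => (1 + p ij.1 ij.2 * (expR s - 1)) ^+ T)
  indep _ _ _.
under eq_integral do rewrite -expR_sum -mulr_sumr.
move=> -> //; last first.
  move=> ij ijJ; apply: binomial_mgf; first exact: p01.
  by move=> B; apply: (count_binomial hmodel); exact: Jlt.
rewrite lee_fin mulr_sumr expR_sum; apply: ler_prod => ij ijJ.
have /andP[p0 p1] := p01 _ ijJ.
have q0 : 0 <= 1 + p ij.1 ij.2 * (expR s - 1).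
  have := expR_gt0 s; rewrite mulrBr mulr1 => es.
  have : 0 <= p ij.1 ij.2 * expR s by rewrite mulr_ge0// ltW.
  lra.
rewrite exprn_ge0//= -mulrA expRM_natl lerXn2r ?nnegrE ?expR_ge0//.
by rewrite mulrC expR_ge1Dx.
Qed.

Lemma counts_event_measurable (k : 'I_n -> 'I_n -> nat) :
  measurable (counts_event N k).
Proof.
rewrite (_ : counts_event N k = \bigcap_(ij in [set ij : 'I_n * 'I_n | (ij.1 < ij.2)%N])
    N ij.1 ij.2 @^-1` [set k ij.1 ij.2]).
  apply: fin_bigcap_measurable => // ij _.
  by apply: measurable_fun_preimage => //; exact: measurable_funPT.
apply/seteqP; split=> w wk.
  by move=> [i j] /= ij; exact: wk.
by move=> i j ij; exact: (wk (i, j)).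
Qed.

Lemma counts_le : {ae P, forall w, forall i j : 'I_n, (i < j)%N -> (N i j w <= T)%N}.
Proof.
apply: filter_forall => i; apply: filter_forall => j.
have [ij|ij] := ltnP i j; last by apply: aeW.
exists (N i j @^-1` [set m | (T < m)%N]); split.
- by apply: measurable_fun_preimage => //; exact: measurable_funPT.
- have /andP[p0 p1] : 0 < p i j <= 1.
    by apply: (rate_range hmodel); rewrite -val_eqE/= ltn_eqF.
  rewrite [LHS](count_binomial hmodel ij) (@binomial_probE _ _ _ (ltW p0) p1).
  rewrite big1// => k _; rewrite diracE memNset ?mule0//= => Tk.
  by have := ltn_ord k; rewrite ltnS leqNgt Tk.
- by move=> w /= h; rewrite ltnNge; apply/negP => ?; apply: h.
Qed.

(** The subtracted square is the bound of [outcome_mgf] on the log-moment generating function, so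
    the exponential of each term has conditional mean at most 1. *)
Definition noise_term (eps : 'I_n -> 'I_n -> R) (lam B : R)
    (ijt : 'I_n * 'I_n * 'I_T) (x : R) : R :=
  let i := ijt.1.1 in let j := ijt.1.2 in
  lam * eps i j * score_on A f (u ord0 i - u ord0 j) x - 2 * (lam * eps i j * B) ^+ 2.

(** Summing over all [t] below [T] with an indicator keeps the index set deterministic. *)
Definition noise_sum (eps : 'I_n -> 'I_n -> R) (lam B : R) (w : Omega) : R :=
  \sum_(ijt : 'I_n * 'I_n * 'I_T | (ijt.1.1 < ijt.1.2)%N)
    (ijt.2 < N ijt.1.1 ijt.1.2 w)%N%:R *
    noise_term eps lam B ijt (X ijt.1.1 ijt.1.2 ijt.2 w).

Lemma measurable_noise_term eps lam B ijt :
  measurable_fun [set: R] (noise_term eps lam B ijt).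
Proof.
apply: measurable_funB => //; apply: measurable_funM => //.
exact: (measurable_score_on hA hf hfc).
Qed.

Lemma measurable_noise_sum eps lam B :
  measurable_fun [set: Omega] (noise_sum eps lam B).
Proof.
apply: measurable_fun_sum => ijt; apply: measurable_funM.
  by apply: (@measurableT_comp _ _ _ _ _ _ (fun k : nat => (ijt.2 < k)%N%:R : R)).
by apply: (measurableT_comp (measurable_noise_term _ _ _ _)); exact: measurable_funPT.
Qed.

(** Given the counts, the observed outcomes are independent and the compensated terms multiply to an
    exponential of mean at most 1, so Chernoff gives the factor [expR (- a)]. This factor is the
    same for every [k], which permits summation over the counts. *)
Lemma noise_tail_cond (eps : 'I_n -> 'I_n -> R) (lam B a : R)
    (k : 'I_n -> 'I_n -> nat) :
  0 <= B ->
  (forall x i j, A x -> `|score f x (u ord0 i - u ord0 j)| <= B) ->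
  (forall i j, `|eps i j| <= 1) -> `|lam| * B <= 2^-1 ->
  (P ([set w | (a <= noise_sum eps lam B w)%R] `&` counts_event N k) <=
   (expR (- a))%:E * P (counts_event N k))%E.
Proof.
move=> B0 sB epsB lamB.
set F := [set w | _]; set E := counts_event N k.
have mE : measurable E by exact: counts_event_measurable.
have mF : measurable F.
  rewrite -[X in measurable X]setTI.
  exact: (measurable_fun_le measurableT (measurable_cst a) (measurable_noise_sum _ _ _)).
have [PE0|PE0] := eqVneq (P E) 0%E.
  rewrite [X in (_ * X)%E]PE0 mule0 -PE0.
  by apply: le_measure; rewrite ?inE//; exact: measurableI.
have [Q QE] := cond_prob_probability mE PE0.
pose D := [set ijt : 'I_n * 'I_n * 'I_T |
  (ijt.1.1 < ijt.1.2)%N && (ijt.2 < k ijt.1.1 ijt.1.2)%N]%SET.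
pose Z w := \sum_(ijt in D) noise_term eps lam B ijt (X ijt.1.1 ijt.1.2 ijt.2 w).
have mZ : measurable_fun [set: Omega] Z.
  apply: measurable_fun_sum => ijt.
  by apply: (measurableT_comp (measurable_noise_term _ _ _ _)); exact: measurable_funPT.
have FZ : F `&` E = [set w | a <= Z w] `&` E.
  apply/seteqP; split=> w [Fw Ew]; split=> //; move: Fw; rewrite /F /=;
    rewrite (_ : noise_sum eps lam B w = Z w)//.
  - rewrite /noise_sum /Z big_mkcond [RHS]big_mkcond; apply: eq_bigr => -[[i j] t] _ /=.
    rewrite inE/=; case: ifP => //= ij; rewrite (Ew i j ij).
    by case: ifP; rewrite ?mul1r ?mul0r.
  - rewrite /noise_sum /Z big_mkcond [RHS]big_mkcond; apply: eq_bigr => -[[i j] t] _ /=.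
    rewrite inE/=; case: ifP => //= ij; rewrite (Ew i j ij).
    by case: ifP; rewrite ?mul1r ?mul0r.
have PEfin : P E \is a fin_num by exact: fin_num_measure.
have QZ : (Q [set w | (a <= Z w)%R] <= (expR (- a))%:E)%E.
  rewrite -[- a]add0r; apply: (@chernoff_bound _ _ _ Q Z a 0 mZ).
  have mgf ijt : exists e : R, ijt \in D -> [/\ 0 <= e, e <= 1 &
      (\int[Q]_w (expR (noise_term eps lam B ijt (X ijt.1.1 ijt.1.2 ijt.2 w)))%:E = e%:E)%E].
    have [ijtD|] := boolP (ijt \in D); last by exists 0.
    move: (ijtD); rewrite inE => /andP[ij tk].
    set i := ijt.1.1; set j := ijt.1.2.
    have dens : has_density Q (X i j ijt.2) kind A (f ^~ (u ord0 i - u ord0 j)).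
      by rewrite QE; apply: (outcome_density hmodel).
    have lB : `|lam * eps i j| * B <= 2^-1.
      apply: le_trans lamB; rewrite ler_wpM2r// normrM ler_piMr//.
    have [e [e0 e1 eE]] := outcome_mgf hA hf hfc dens B0 (fun x Ax => sB x i j Ax) lB.
    exists (e * expR (- (2 * (lam * eps i j * B) ^+ 2))) => _; split.
    - by rewrite mulr_ge0// expR_ge0.
    - by rewrite expRN ler_pdivrMr ?expR_gt0// mul1r.
    - rewrite EFinM -eE muleC -ge0_integralZl//.
      + by apply: eq_integral => w _; rewrite -EFinM -expRD addrC.
      + apply/measurable_EFinP; apply: measurableT_comp => //.
        apply: measurable_funM => //; apply: measurableT_comp; last exact: measurable_funPT.
        exact: (measurable_score_on hA hf hfc).
  have {}mgf := choice mgf.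
  have [e eP] := mgf.
  have indep : mutually_independent Q D (fun ijt => X ijt.1.1 ijt.1.2 ijt.2).
    by rewrite QE; exact: (outcome_indep hmodel).
  have := @expectation_prod_indep _ _ _ _ _ Q _ D
    (fun ijt => X ijt.1.1 ijt.1.2 ijt.2)
    (fun ijt x => expR (noise_term eps lam B ijt x)) e indep _ _ _.
  under eq_integral do rewrite -expR_sum.
  move=> ->; last 3 first.
  - move=> ijt; apply: measurableT_comp; first exact: measurable_expR.
    exact: measurable_noise_term.
  - by move=> ijt x; exact: expR_ge0.
  - by move=> ijt /eP[].
  rewrite expR0 lee_fin; apply: prodr_ile1 => ijt /eP[e0 e1 _].
  by rewrite e0.
move: QZ; rewrite QE /cond_prob -FZ => QZ.
have : (P (F `&` E) / P E * P E <= (expR (- a))%:E * P E)%E by exact: lee_wpmul2r.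
by rewrite -muleA -[P E]fineK// inver fine_eq0// (negbTE PE0) -EFinM mulVf ?mule1// fine_eq0.
Qed.

End model.

Section decomposition.
Context (R : realType) (kind : outcome_kind) (A : set R) (f : R -> R -> R)
  (T : nat) (d : measure_display) (Omega : measurableType d)
  (P : probability Omega R) (n : nat) (u : 'rV[R]_n) (p : 'I_n -> 'I_n -> R)
  (N : 'I_n -> 'I_n -> {RV P >-> nat}) (X : 'I_n -> 'I_n -> nat -> {RV P >-> R}).
Hypotheses (hA : outcome_set kind A) (hf : valid kind A f)
  (hfc : strictly_log_concave A f)
  (hmodel : sampling_model kind A f T u p N X).

(* The counts are almost surely at most [T], so finitely many values of the
   counts matter; those off the pairs [i < j] are set to 0 to keep the
   corresponding events disjoint. *)
Lemma counts_decomposition (F : set Omega) (b : R) :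
  measurable F -> 0 <= b ->
  (forall k, P (F `&` counts_event N k) <= b%:E * P (counts_event N k))%E ->
  (P F <= b%:E)%E.
Proof.
move=> mF b0 hF.
pose K := [set k : {ffun 'I_n * 'I_n -> 'I_T.+1} |
  forall ij : 'I_n * 'I_n, ~~ (ij.1 < ij.2)%N -> k ij = ord0].
pose E (k : {ffun 'I_n * 'I_n -> 'I_T.+1}) := counts_event N (fun i j => k (i, j)).
have mE k : measurable (E k) by exact: counts_event_measurable.
have trivE : trivIset K E.
  move=> k k' Kk Kk' [w [wk wk']]; apply/ffunP => -[i j].
  have [ij|ij] := boolP (i < j)%N; last by rewrite Kk// Kk'.
  by apply/val_inj; rewrite /= -(wk i j ij) -(wk' i j ij).
have finK : finite_set K by exact: finite_finset.
apply: (@ae_eventW _ _ _ P _ F (\bigcup_(k in K) (F `&` E k)) _ (counts_le hmodel) mF).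
- by apply: fin_bigcup_measurable => // k _; exact: measurableI.
- move=> w [Fw Nw].
  exists [ffun ij : 'I_n * 'I_n => if (ij.1 < ij.2)%N then inord (N ij.1 ij.2 w) else ord0].
    by move=> ij ijN; rewrite ffunE (negbTE ijN).
  by split=> // i j ij; rewrite ffunE/= ij inordK// ltnS Nw.
- rewrite measure_fin_bigcup//; last 2 first.
  + move=> k k' Kk Kk' [w [[_ wk] [_ wk']]]; apply: trivE => //.
    by exists w.
  + by move=> k _; exact: measurableI.
  apply: (@le_trans _ _ (\sum_(k \in K) (b%:E * P (E k)))%E).
    by apply: lee_fsum => // k _; exact: hF.
  rewrite -ge0_mule_fsumr//.
  rewrite -[leRHS]mule1 lee_wpmul2l ?lee_fin//.
  have <- := @measure_fin_bigcup _ _ _ P _ K E finK trivE (fun k _ => mE k).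
  by apply: probability_le1; exact: fin_bigcup_measurable.
Qed.

Lemma noise_tail (eps : 'I_n -> 'I_n -> R) (lam B a : R) :
  0 <= B ->
  (forall x i j, A x -> `|score f x (u ord0 i - u ord0 j)| <= B) ->
  (forall i j, `|eps i j| <= 1) -> `|lam| * B <= 2^-1 ->
  (P [set w | (a <= noise_sum A f T u N X eps lam B w)%R] <= (expR (- a))%:E)%E.
Proof.
move=> B0 sB epsB lamB; apply: counts_decomposition => [||k].
- rewrite -[X in measurable X]setTI.
  apply: measurable_fun_le => //; exact: (measurable_noise_sum T u N X hA hf hfc eps lam B).
- exact: expR_ge0.
- exact: (noise_tail_cond hA hf hfc hmodel).
Qed.

(** Given the counts, an outcome outside [A] has probability the integral of its density over an
    empty set; [counts_decomposition] with bound 0 removes the conditioning. *)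
Lemma outcomes_in : {ae P, forall w, forall i j : 'I_n, (i < j)%N ->
  forall t : 'I_T, (t < N i j w)%N -> A (X i j t w)}.
Proof.
apply: filter_forall => i; apply: filter_forall => j.
have [ij|ij] := ltnP i j; last by apply: aeW.
suff : {ae P, forall w, forall t : 'I_T, (t < N i j w)%N -> A (X i j t w)}.
  by apply: filterS => w h _.
apply: filter_forall => t.
have mA := outcome_set_measurable hA.
have mN : measurable (N i j @^-1` [set m | (t < m)%N]).
  by apply: measurable_fun_preimage => //; exact: measurable_funPT.
have mX : measurable (X i j t @^-1` (~` A)).
  by apply: measurable_fun_preimage; [exact: measurable_funPT|exact: measurableC].
exists (N i j @^-1` [set m | (t < m)%N] `&` X i j t @^-1` (~` A)); split.
- exact: measurableI.
- apply/eqP; rewrite eq_le measure_ge0 andbT.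
  apply: counts_decomposition => //; first exact: measurableI.
  move=> k; rewrite mul0e.
  set E := counts_event N k; have mE : measurable E by exact: counts_event_measurable.
  have [PE0|PE0] := eqVneq (P E) 0%E.
    rewrite -PE0; apply: le_measure; rewrite ?inE//.
    by apply: measurableI => //; exact: measurableI.
  have [tk|tk] := ltnP t (k i j); last first.
    rewrite (_ : _ `&` E = set0) ?measure0// -subset0 => w [[/= tN _] Ew].
    by move: tN; rewrite (Ew i j ij) ltnNge tk.
  have := outcome_density hmodel PE0 ij tk (measurableC mA).
  rewrite setICr.
  have -> : base_integral kind set0 (f ^~ (u ord0 i - u ord0 j)) = 0%E.
    by rewrite /base_integral; case: (kind); rewrite ?integral_set0 ?esum_set0.
  rewrite /cond_prob => Q0.
  have PX0 : P (X i j t @^-1` (~` A) `&` E) = 0%E.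
    apply/eqP; move: Q0 => /eqP; rewrite mule_eq0 => /orP[//|].
    have PEfin : P E \is a fin_num by exact: fin_num_measure.
    rewrite -[P E]fineK// inver fine_eq0// (negbTE PE0) eqe invr_eq0 fine_eq0//.
    by rewrite (negbTE PE0).
  rewrite -PX0; apply: le_measure; rewrite ?inE; [|exact: measurableI|].
    by apply: measurableI => //; exact: measurableI.
  by move=> w [[_ wX] wE]; split.
- by move=> w /= /not_implyP[h1 h2]; split.
Qed.

End decomposition.

(** * Sums and cardinalities of cuts in terms of unordered pairs *)

Lemma sum_pairs (R : realType) (n : nat) (F : 'I_n -> 'I_n -> R) :
  \sum_i \sum_(j | i != j) F i j =
  \sum_(ij : 'I_n * 'I_n | (ij.1 < ij.2)%N) (F ij.1 ij.2 + F ij.2 ij.1).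
Proof.
rewrite pair_big_dep/= (bigID (fun ij : 'I_n * 'I_n => (ij.1 < ij.2)%N))/= big_split/=.
congr (_ + _).
  apply: eq_bigl => -[i j] /=; rewrite -val_eqE/=.
  by case: ltngtP.
rewrite (reindex_inj (h := fun ij : 'I_n * 'I_n => (ij.2, ij.1)))/=; last first.
  by move=> [i j] [i' j'] [-> ->].
by apply: eq_bigl => -[i j] /=; rewrite -val_eqE/=; case: ltngtP.
Qed.

Lemma sum_cut_pairs (R : realType) (n : nat) (S : {set 'I_n})
    (F : 'I_n -> 'I_n -> R) :
  \sum_(i in S) \sum_(j in ~: S) F i j =
  \sum_(ij : 'I_n * 'I_n | (ij.1 < ij.2)%N)
    (((ij.1 \in S) && (ij.2 \notin S))%:R * F ij.1 ij.2 +
     ((ij.2 \in S) && (ij.1 \notin S))%:R * F ij.2 ij.1).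
Proof.
rewrite -(sum_pairs (fun i j => ((i \in S) && (j \notin S))%:R * F i j)).
rewrite big_mkcond/=; apply: eq_bigr => i _; case: ifP => iS /=; last first.
  by rewrite big1// => j _; rewrite mul0r.
rewrite big_mkcond/= [RHS]big_mkcond/=; apply: eq_bigr => j _.
rewrite inE; case: eqVneq => [<-|_]; first by rewrite iS.
by case: (j \in S); rewrite /= ?mul0r ?mul1r.
Qed.

(** Each unordered pair occurs once, smaller index first, because the independence assumptions
    concern such pairs. *)
Definition cut_pairs (n : nat) (S : {set 'I_n}) : {set 'I_n * 'I_n} :=
  [set ij : 'I_n * 'I_n | (ij.1 < ij.2)%N && ((ij.1 \in S) != (ij.2 \in S))]%SET.

Definition pairs_at (n : nat) (k : 'I_n) : {set 'I_n * 'I_n} :=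
  [set ij : 'I_n * 'I_n | (ij.1 < ij.2)%N && ((ij.1 == k) || (ij.2 == k))]%SET.

Lemma sum_cut_sym (R : realType) (n : nat) (S : {set 'I_n})
    (F : 'I_n -> 'I_n -> R) :
  (forall i j, i != j -> F i j = F j i) ->
  \sum_(i in S) \sum_(j in ~: S) F i j = \sum_(ij in cut_pairs S) F ij.1 ij.2.
Proof.
move=> FC; rewrite sum_cut_pairs [LHS]big_mkcond [RHS]big_mkcond.
apply: eq_bigr => -[i j] _ /=; rewrite inE/=; case: ltnP => //= ij.
rewrite [F j i]FC; last by rewrite -val_eqE/= gtn_eqF.
by case: (i \in S); case: (j \in S); rewrite /= ?mul0r ?mul1r ?addr0 ?add0r.
Qed.

Lemma sum_cut_antisym_pairs (R : realType) (n : nat) (S : {set 'I_n})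
    (F : 'I_n -> 'I_n -> R) :
  (forall i j, i != j -> F i j = - F j i) ->
  \sum_(i in S) \sum_(j in ~: S) F i j =
  \sum_(ij : 'I_n * 'I_n | (ij.1 < ij.2)%N)
    ((ij.1 \in S)%:R - (ij.2 \in S)%:R) * F ij.1 ij.2.
Proof.
move=> FN; rewrite sum_cut_pairs; apply: eq_bigr => -[i j] /= ij.
rewrite [F j i]FN; last by rewrite -val_eqE/= gtn_eqF.
by case: (i \in S); case: (j \in S) => /=; ring.
Qed.

Lemma sum_at_sym (R : realType) (n : nat) (k : 'I_n) (F : 'I_n -> 'I_n -> R) :
  (forall i j, i != j -> F i j = F j i) ->
  \sum_(i | i != k) F i k = \sum_(ij in pairs_at k) F ij.1 ij.2.
Proof.
move=> FC.
transitivity (\sum_i \sum_(j | i != j) (j == k)%:R * F i j).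
  rewrite big_mkcond; apply: eq_bigr => i _; case: ifPn => ik.
    rewrite (bigD1 k)//= eqxx mul1r big1 ?addr0// => j /andP[_ /negbTE ->].
    by rewrite mul0r.
  rewrite big1// => j; rewrite negbK in ik; rewrite (eqP ik) eq_sym => /negbTE ->.
  by rewrite mul0r.
rewrite (sum_pairs (fun i j => (j == k)%:R * F i j)).
rewrite [LHS]big_mkcond [RHS]big_mkcond.
apply: eq_bigr => -[i j] _ /=; rewrite inE/=; case: ltnP => //= ij.
rewrite [F j i]FC; last by rewrite -val_eqE/= gtn_eqF.
case: (eqVneq j k) => [jk|_]; case: (eqVneq i k) => [ik|_];
  rewrite /= ?mul0r ?mul1r ?addr0 ?add0r//.
by move: ij; rewrite ik jk ltnn.
Qed.

(** Orienting each crossing pair from its endpoint in [S] to the other endpoint is a bijection onto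
    the product of [S] and its complement. *)
Lemma card_cut_pairs (n : nat) (S : {set 'I_n}) :
  #|cut_pairs S| = (#|S| * (n - #|S|))%N.
Proof.
have nS : (n - #|S| = #|~: S|)%N.
  by rewrite -[n in (n - _)%N]card_ord -(cardsC S) addKn.
rewrite nS -cardsX.
pose h (ij : 'I_n * 'I_n) := if ij.1 \in S then ij else (ij.2, ij.1).
rewrite -(card_in_imset (f := h) (D := cut_pairs S)).
  congr #|pred_of_set _|; apply/setP => -[i j]; rewrite !inE/=.
  apply/imsetP/andP => [[[a b]]|[iS jS]].
    rewrite inE/= /h /= => /andP[_ ab]; case: ifP ab => aS ab [-> ->];
      by rewrite aS; case: (b \in S) ab.
  have ij : i != j by apply: contraNneq jS => <-.
  have [ltij|ltji] := ltnP i j.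
    by exists (i, j); rewrite /h/= ?iS// inE/= ltij iS (negbTE jS).
  exists (j, i); last by rewrite /h /= (negbTE jS).
  rewrite inE/= iS (negbTE jS) andbT ltn_neqAle ltji andbT.
  by move: ij; rewrite -val_eqE eq_sym.
move=> [i j] [i' j']; rewrite !inE/= /h/= => /andP[ij ijS] /andP[ij' ijS'].
case: ifP ijS => iS ijS; case: ifP ijS' => iS' ijS' [] E1 E2.
- by rewrite E1 E2.
- by move: ij ij'; rewrite E1 E2 => ? /ltnW; rewrite leqNgt => /negP.
- by move: ij ij'; rewrite -E1 -E2 => ? /ltnW; rewrite leqNgt => /negP.
- by rewrite E1 E2.
Qed.

Lemma card_pairs_at (n : nat) (k : 'I_n) : (#|pairs_at k| <= n)%N.
Proof.
pose h (ij : 'I_n * 'I_n) := if ij.1 == k then ij.2 else ij.1.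
rewrite -[leqRHS]card_ord -(card_in_imset (f := h) (D := pairs_at k)).
  exact: max_card.
move=> [i j] [i' j']; rewrite !inE/= /h/= => /andP[ij ijk] /andP[ij' ijk'].
case: (eqVneq i k) ijk => [ik|ik] /= ijk;
  case: (eqVneq i' k) ijk' => [ik'|ik'] /= ijk' E.
- by rewrite ik ik' E.
- by move: ij'; rewrite -E (eqP ijk') -ik => /(ltn_trans ij); rewrite ltnn.
- by move: ij; rewrite E (eqP ijk) -ik' => /(ltn_trans ij'); rewrite ltnn.
- by rewrite E (eqP ijk) (eqP ijk').
Qed.

(** Everything is evaluated at one sample point: the edge weights are the counts, and [W] and [G]
    sum log-densities and scores over the observed comparisons. A positive weight means at least one
    observed comparison, hence strict concavity on that pair. *)
Lemma mle_of_events (R : realType) (kind : outcome_kind) (A : set R)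
    (f : R -> R -> R) (n : nat) (u : 'rV[R]_n.+1)
    (N : 'I_n.+1 -> 'I_n.+1 -> nat) (X : 'I_n.+1 -> 'I_n.+1 -> nat -> R)
    (M sigma m D eta : R) (l : nat) :
  outcome_set kind A -> valid kind A f -> strictly_log_concave A f ->
  (forall i j, i != j -> N i j = N j i) ->
  (forall i j t, i != j -> (t < N i j)%N -> X j i t = - X i j t) ->
  (forall (i j : 'I_n.+1) t, (i < j)%N -> (t < N i j)%N -> A (X i j t)) ->
  0 < sigma -> 0 < m -> 0 < D -> 0 < eta ->
  (forall x y, A x -> - (M + 1) <= y -> y <= M + 1 -> dscore f x y <= - sigma) ->
  anchored u -> (forall i j, `|u ord0 i - u ord0 j| <= M) ->
  (forall S : {set 'I_n.+1}, S != finset.set0 -> (2 * #|S| <= n.+1)%N ->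
     m * #|S|%:R <= \sum_(ij in cut_pairs S) (N ij.1 ij.2)%:R) ->
  (forall k, \sum_(ij in pairs_at k) (N ij.1 ij.2)%:R <= D * m) ->
  (forall S : {set 'I_n.+1}, S != finset.set0 -> (2 * #|S| <= n.+1)%N ->
     `|\sum_(ij : 'I_n.+1 * 'I_n.+1 | (ij.1 < ij.2)%N)
         ((ij.1 \in S)%:R - (ij.2 \in S)%:R) *
         \sum_(t < N ij.1 ij.2)
           score f (X ij.1 ij.2 t) (u ord0 ij.1 - u ord0 ij.2)|
       <= sigma * (eta / 2 * m * #|S|%:R)) ->
  n.+1%:R < (1 + (2 * D)^-1) ^+ l -> 2 * l%:R * eta < 1 ->
  exists v, unique (is_mle f N X) v /\
    forall i j, (v ord0 i - u ord0 i) - (v ord0 j - u ord0 j) <= 2 * l%:R * eta.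
Proof.
move=> hA hf hfc NC XN XA sigma0 m0 D0 eta0 curv uanch uM cut deg noise nl small.
have {}XA i j t : i != j -> (t < N i j)%N -> A (X i j t).
  rewrite neq_ltn => /orP[ij|ji] tN; first exact: XA.
  have ji' : j != i by rewrite -val_eqE/= ltn_eqF.
  have tN' : (t < N j i)%N by rewrite NC.
  by rewrite XN//; case: hA => + _; apply; exact: XA.
pose W i j y := \sum_(t < N i j) ln (f (X i j t) y).
pose G i j y := \sum_(t < N i j) score f (X i j t) y.
pose a i j : R := (N i j)%:R.
have GN i j y : i != j -> G i j y = - G j i (- y).
  move=> ij; rewrite /G -sumrN.
  rewrite -(big_mkord xpredT (fun t => score f (X i j t) y)).
  rewrite -(big_mkord xpredT (fun t => - score f (X j i t) (- y))) (NC i j ij).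
  rewrite !big_mkord; apply: eq_bigr => t _; have ji : j != i by rewrite eq_sym.
  by rewrite (XN j i)// -[y in LHS]opprK (scoreN hA hf hfc)//; apply: XA.
have [||||||||||||||||||v [vanch vmax vuniq vspread]] :=
  @maximizer_near_center R n W G a u M sigma m D eta l.
- by move=> i j; rewrite /a.
- by move=> i j ij; rewrite /a NC.
- exact: sigma0.
- exact: m0.
- exact: D0.
- exact: eta0.
- move=> i j ij; apply: continuous_sum_fin => t _ y.
  apply: differentiable_continuous; apply/derivable1_diffP.
  by apply: (loglik_derivable hfc); apply: XA.
- exact: GN.
- move=> i j y z ij; rewrite /G mulr_suml -big_split; apply: ler_sum => t _ /=.
  by apply: (log_tangent hfc); apply: XA.
- move=> i j y z ij; rewrite /a ltr0n => Nij zy; rewrite /W /G mulr_suml -big_split/=.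
  apply: ltr_sum.
    by apply/hasP; exists (Ordinal Nij); rewrite ?mem_index_enum.
  by move=> t _; apply: (log_tangent_strict hfc) => //; apply: XA.
- move=> i j y z ij My yz zM; rewrite /G -sumrB /a.
  have -> : - (sigma * (N i j)%:R * (z - y)) = \sum_(t < N i j) - sigma * (z - y).
    by rewrite sumr_const card_ord -mulr_natl; ring.
  apply: ler_sum => t _; apply: (@slope_le R _ (- (M + 1)) (M + 1)) => //.
    by move=> x; apply: (score_derivable hfc); apply: XA.
  by move=> x x1 x2; apply: curv => //; apply: XA.
- exact: uanch.
- exact: uM.
- move=> S S0 Sn; rewrite sum_cut_sym//; first exact: cut.
  by move=> i j ij; rewrite /a NC.
- by move=> k; rewrite sum_at_sym// => i j ij; rewrite /a NC.
- move=> S S0 Sn.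
  rewrite (@sum_cut_antisym_pairs _ _ _ (fun i j => G i j (u ord0 i - u ord0 j))).
    exact: noise.
  by move=> i j ij; rewrite GN// opprB.
- exact: nl.
- exact: small.
have lE v' : loglik f N X v' = 2^-1 * pair_objective W v' by [].
exists v; split=> //; split.
  by split=> // v' v'anch; rewrite !lE ler_pM2l ?invr_gt0// vmax.
move=> v' [v'anch v'max]; apply: vuniq => //.
by have := v'max v vanch; rewrite !lE ler_pM2l ?invr_gt0.
Qed.

(** * Union bounds and the good event *)

Lemma union_bound (R : realType) (d : measure_display)
    (Omega : measurableType d) (P : probability Omega R) (I : finType)
    (F : I -> set Omega) (b : I -> R) :
  (forall i, measurable (F i)) -> (forall i, P (F i) <= (b i)%:E)%E ->
  exists V, [/\ measurable V, (P V <= (\sum_i b i)%:E)%E & forall i, F i `<=` V].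
Proof.
move=> mF Fb.
suff [V [mV PV FV]] : exists V, [/\ measurable V,
    (P V <= (\sum_(i <- index_enum I) b i)%:E)%E &
    forall i, i \in index_enum I -> F i `<=` V].
  by exists V; split=> // i; apply: FV; rewrite mem_index_enum.
elim: (index_enum I) => [|i s [V [mV PV FV]]].
  by exists set0; split=> //; rewrite measure0 big_nil.
exists (F i `|` V); split; first exact: measurableU.
  apply: (le_trans (measureU2 P (mF i) mV)).
  by rewrite big_cons EFinD; exact: leeD (Fb i) PV.
move=> j; rewrite inE => /predU1P[->|/FV]; first exact: subsetUl.
by move=> /subset_trans; apply; exact: subsetUr.
Qed.

(** The sum over all sets is (1 + x)^n, so without the empty set it is at most e^(n x) - 1. A bound
    geometric in the size of the set thus loses only a factor 2 against a union over single
    items. *)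
Lemma sum_nonempty_sets (R : realType) (n : nat) (x : R) : 0 <= x ->
  n%:R * x <= 2^-1 ->
  \sum_(S : {set 'I_n}) (if S == finset.set0 then 0 else x ^+ #|S|) <= 2 * (n%:R * x).
Proof.
move=> x0 nx.
have : \sum_(S : {set 'I_n}) x ^+ #|S| = (1 + x) ^+ n.
  have := @bigA_distr R 0 1 *%R +%R 'I_n (fun=> x) (fun=> 1).
  rewrite /= prodr_const card_ord addrC => ->; apply: eq_bigr => S _.
  by rewrite -big_mkcond/= prodr_const.
rewrite (bigD1 finset.set0)//= cards0 expr0 => E.
rewrite (bigD1 finset.set0)//= eqxx add0r.
rewrite (eq_bigr (fun S : {set 'I_n} => x ^+ #|S|)); last by move=> S /negbTE ->.
have : (1 + x) ^+ n <= expR (n%:R * x).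
  by rewrite expRM_natl lerXn2r ?nnegrE ?expR_ge0 ?addr_ge0 ?expR_ge1Dx.
have nx0 : 0 <= n%:R * x by rewrite mulr_ge0.
have := @expR_le_quadratic R (n%:R * x); rewrite ger0_norm// => /(_ nx).
have : (n%:R * x) ^+ 2 <= 2^-1 * (n%:R * x) by rewrite expr2 ler_wpM2r.
by move: E; lra.
Qed.

Definition cut_sign (R : realType) (n : nat) (S : {set 'I_n}) (i j : 'I_n) : R :=
  (i \in S)%:R - (j \in S)%:R.

(** The square of [cut_sign] is the indicator of the crossing pairs, so the compensators add up to a
    multiple of the number of comparisons across the cut. *)
Lemma noise_sumE (R : realType) (A : set R) (f : R -> R -> R) (T : nat)
    (d : measure_display) (Omega : measurableType d) (P : probability Omega R)
    (n : nat) (u : 'rV[R]_n) (N : 'I_n -> 'I_n -> {RV P >-> nat})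
    (X : 'I_n -> 'I_n -> nat -> {RV P >-> R}) (S : {set 'I_n}) (lam B : R)
    (w : Omega) :
  (forall i j : 'I_n, (i < j)%N -> (N i j w <= T)%N) ->
  (forall i j : 'I_n, (i < j)%N ->
     forall t : 'I_T, (t < N i j w)%N -> A (X i j t w)) ->
  noise_sum A f T u N X (cut_sign R S) lam B w =
  lam * (\sum_(ij : 'I_n * 'I_n | (ij.1 < ij.2)%N)
      ((ij.1 \in S)%:R - (ij.2 \in S)%:R) *
      \sum_(t < N ij.1 ij.2 w)
        score f (X ij.1 ij.2 t w) (u ord0 ij.1 - u ord0 ij.2))
  - 2 * (lam * B) ^+ 2 * \sum_(ij in cut_pairs S) (N ij.1 ij.2 w)%:R.
Proof.
move=> NT XA.
have -> : \sum_(ij in cut_pairs S) (N ij.1 ij.2 w)%:R =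
    \sum_(ij : 'I_n * 'I_n | (ij.1 < ij.2)%N)
      cut_sign R S ij.1 ij.2 ^+ 2 * (N ij.1 ij.2 w)%:R.
  rewrite big_mkcond [RHS]big_mkcond; apply: eq_bigr => -[i j] _.
  rewrite inE/= /cut_sign; case: ltnP => //= _.
  by case: (i \in S); case: (j \in S) => /=; ring.
rewrite !mulr_sumr -sumrB /noise_sum.
transitivity (\sum_(ij : 'I_n * 'I_n | (ij.1 < ij.2)%N) \sum_(t < T)
    (t < N ij.1 ij.2 w)%N%:R *
    noise_term A f u (cut_sign R S) lam B (ij, t) (X ij.1 ij.2 t w)).
  by rewrite pair_big/=; apply: eq_big => [[ij t]|[ij t]] //=; rewrite andbT.
apply: eq_bigr => -[i j] /= ij.
rewrite (big_ord_widen T (fun t => score f (X i j t w) (u ord0 i - u ord0 j)) (NT i j ij)).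
have -> : (N i j w)%:R = \sum_(t < T | (t < N i j w)%N) (1 : R).
  by rewrite -(big_ord_widen T (fun=> 1) (NT i j ij)) sumr_const card_ord.
rewrite !mulrA !mulr_sumr -sumrB [RHS]big_mkcond; apply: eq_bigr => t _.
case: ifP => tN; last by rewrite mul0r.
by rewrite mul1r /noise_term/= score_onE; [rewrite /cut_sign; ring|exact: XA].
Qed.

(** Besides a null set, four events are excluded: a small cut, a large degree, and large noise of
    either sign. Their costs 2, 1, 2, 2 add up to the factor 7; the degrees need a union over items
    only, the others over sets. *)
Lemma mle_high_probability (R : realType) (kind : outcome_kind) (A : set R)
    (f : R -> R -> R) (T : nat) (d : measure_display) (Omega : measurableType d)
    (P : probability Omega R) (n : nat) (u : 'rV[R]_n.+1)
    (p : 'I_n.+1 -> 'I_n.+1 -> R)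
    (N : 'I_n.+1 -> 'I_n.+1 -> {RV P >-> nat})
    (X : 'I_n.+1 -> 'I_n.+1 -> nat -> {RV P >-> R})
    (M B sigma pm qm lam L D eta : R) (l : nat) (m := n.+1%:R * pm / 8) :
  outcome_set kind A -> valid kind A f -> strictly_log_concave A f ->
  (1 <= T)%N -> sampling_model kind A f T u p N X ->
  0 < pm -> pm <= qm -> (forall i j, i != j -> pm <= p i j <= qm) ->
  (forall i j, `|u ord0 i - u ord0 j| <= M) ->
  0 <= B -> (forall x y, A x -> `|y| <= M -> `|score f x y| <= B) ->
  0 < sigma ->
  (forall x y, A x -> - (M + 1) <= y -> y <= M + 1 -> dscore f x y <= - sigma) ->
  0 < lam -> lam * B <= 2^-1 -> 0 <= L -> 40 * L <= n.+1%:R * pm ->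
  n.+1%:R * expR (- (5 * L)) <= 2^-1 ->
  0 < D -> 4 * (T%:R * (n.+1%:R * qm)) <= D * m -> 0 < eta ->
  5 * L + 2 * (lam * B) ^+ 2 * (D * m) <= lam * (sigma * (eta / 2 * m)) ->
  n.+1%:R < (1 + (2 * D)^-1) ^+ l -> 2 * l%:R * eta < 1 ->
  exists E : set Omega, [/\ measurable E,
    ((1 - 7 * (n.+1%:R * expR (- (5 * L))))%:E <= P E)%E &
    forall w, E w -> exists v : 'rV[R]_n.+1,
      unique (is_mle f (fun i j => N i j w) (fun i j t => X i j t w)) v /\
      forall i j, (v ord0 i - u ord0 i) - (v ord0 j - u ord0 j) <= 2 * l%:R * eta].
Proof.
move=> hA hf hfc T1 hmodel pm0 pq pmq uM B0 sB sigma0 curv lam0 lamB L0 Lp xn D0 Dm eta0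
  noisenum nl small.
set x := expR (- (5 * L)) in xn *.
have n0 : 0 < n.+1%:R :> R by rewrite ltr0n.
have m0 : 0 < m by rewrite /m divr_gt0// mulr_gt0.
have T1' : 1 <= T%:R :> R by rewrite ler1n.
have x0 : 0 <= x by exact: expR_ge0.
have xE k : x ^+ k = expR (- (5 * L * k%:R)) by rewrite -expRM_natr mulNr.
pose active (S : {set 'I_n.+1}) := (S != finset.set0) && (2 * #|S| <= n.+1)%N.
pose b (S : {set 'I_n.+1}) : R := if S == finset.set0 then 0 else x ^+ #|S|.
have b0 S : 0 <= b S by rewrite /b; case: ifP => // _; exact: exprn_ge0.
have mcount J : measurable_fun [set: Omega]
    (fun w => \sum_(ij in (J : {set 'I_n.+1 * 'I_n.+1})) (N ij.1 ij.2 w)%:R : R).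
  apply: measurable_fun_sum => ij.
  by apply: (@measurableT_comp _ _ _ _ _ _ (fun k : nat => k%:R : R)).
have mle_event (a : R) (Z : Omega -> R) : measurable_fun [set: Omega] Z ->
    measurable [set w | a <= Z w].
  by move=> mZ; rewrite -[X in measurable X]setTI; exact: measurable_fun_le.
have guard (F : {set 'I_n.+1} -> set Omega) :
    (forall S, measurable (F S)) ->
    (forall S, active S -> (P (F S) <= (expR (- (5 * L * #|S|%:R)))%:E)%E) ->
    exists V, [/\ measurable V, (P V <= (2 * (n.+1%:R * x))%:E)%E &
      forall S w, active S -> ~ V w -> ~ F S w].
  move=> mF Fb.
  have [S|S|V [mV PV FV]] := @union_bound _ _ _ P _
    (fun S => if active S then F S else set0) b.
  - by case: ifP.
  - case: ifP => [aS|_]; last by rewrite measure0 lee_fin.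
    apply: (le_trans (Fb S aS)); rewrite /b ifF ?xE//.
    by apply/negbTE; case/andP: aS.
  - exists V; split=> //.
      by apply: (le_trans PV); rewrite lee_fin; exact: sum_nonempty_sets.
    by move=> S w aS Vw Fw; apply: Vw; apply: (FV S); rewrite aS.
have [|S aS|V1 [mV1 PV1 V1P]] := guard (fun S =>
  [set w | - (m * #|S|%:R) <= -1 * \sum_(ij in cut_pairs S) (N ij.1 ij.2 w)%:R]).
- by move=> S; apply: mle_event; apply: measurable_funM => //; exact: mcount.
(* With n items and |S| = s <= n / 2, the rates across the cut sum to at least n pm s / 2, and T (1
   - 1/e) >= 1/2. The exponent is thus at most - n pm s / 4 + m s = - n pm s / 8, and 40 L <= n pm
   makes this at most - 5 L s. *)
- apply: (le_trans (count_tail hmodel _ _ _)).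
    by move=> ij; rewrite inE => /andP[].
  rewrite lee_fin ler_expR; set s := #|S|%:R.
  have /andP[_ Sn] := aS.
  have s2 : 2 * s <= n.+1%:R by rewrite /s -natrM ler_nat.
  have s0 : 0 <= s by exact: ler0n.
  set q := \sum_(ij in _) _.
  have qge : pm * (s * (n.+1%:R - s)) <= q.
    rewrite /s -natrB; last by rewrite -[leqRHS]card_ord max_card.
    rewrite -natrM -card_cut_pairs mulr_natr -sumr_const /q.
    apply: ler_sum => ij; rewrite inE => /andP[lt _].
    by have /andP[] := @pmq ij.1 ij.2 (negbT (ltn_eqF lt)).
  have q2 : pm * s * n.+1%:R / 2 <= q.
    apply: le_trans qge; rewrite -mulrA -mulrA ler_pM2l// ler_wpM2l//; lra.
  have e1 : expR (-1) <= 2^-1 :> R.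
    rewrite expRN lef_pV2 ?posrE ?expR_gt0//.
    by apply: (le_trans _ (expR_ge1Dx 1)); lra.
  have q0 : 0 <= q by apply: le_trans q2; rewrite divr_ge0// !mulr_ge0// ltW.
  have h1 : 2^-1 <= T%:R * (1 - expR (-1)) :> R.
    have : 1 * (1 - expR (-1)) <= T%:R * (1 - expR (-1)) :> R.
      by rewrite ler_wpM2r//; lra.
    by lra.
  have h2 : q * 2^-1 <= q * (T%:R * (1 - expR (-1))) by rewrite ler_wpM2l.
  have h3 : 40 * L * s <= n.+1%:R * pm * s by rewrite ler_wpM2r.
  by rewrite /m; lra.
have [k|k|V2 [mV2 PV2 V2P]] := @union_bound _ _ _ P 'I_n.+1
  (fun k => [set w | D * m <= 1 * \sum_(ij in pairs_at k) (N ij.1 ij.2 w)%:R]) (fun=> x).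
- by apply: mle_event; apply: measurable_funM => //; exact: mcount.
(* As e - 1 <= 3 and D m >= 4 T n qm, with n items, the exponent is at most - T n qm <= - n pm <= -
   5 L. *)
- apply: (le_trans (count_tail hmodel _ _ _)).
    by move=> ij; rewrite inE => /andP[].
  rewrite lee_fin ler_expR; set q := \sum_(ij in _) _.
  have qm0 : 0 < qm by exact: lt_le_trans pq.
  have qle : q <= n.+1%:R * qm.
    apply: (@le_trans _ _ (\sum_(ij in pairs_at k) qm)).
      apply: ler_sum => ij; rewrite inE => /andP[lt _].
      by have /andP[] := @pmq ij.1 ij.2 (negbT (ltn_eqF lt)).
    rewrite sumr_const -[leLHS]mulr_natl ler_wpM2r ?ler_nat ?card_pairs_at//.
    exact: ltW.
  have e1 : expR 1 <= 4 :> R.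
    rewrite [X in expR X](_ : 1 = 2%:R * 2^-1); last by field.
    rewrite expRM_natl; have := @expR_le_quadratic R 2^-1.
    rewrite ger0_norm// => /(_ (lexx _)) h.
    have h2 : expR 2^-1 <= 2 :> R by lra.
    apply: (@le_trans _ _ (2 ^+ 2)); last by lra.
    by rewrite lerXn2r ?nnegrE ?expR_ge0.
  have e2 : 0 <= expR 1 - 1 :> R by have := expR_ge1Dx (1 : R); lra.
  have h1 : T%:R * (expR 1 - 1) * q <= T%:R * 3 * (n.+1%:R * qm).
    apply: (@le_trans _ _ (T%:R * (expR 1 - 1) * (n.+1%:R * qm))).
      by rewrite ler_wpM2l// mulr_ge0.
    have h0 : T%:R * (expR 1 - 1) <= T%:R * 3 :> R by rewrite ler_wpM2l//; lra.
    by apply: ler_wpM2r h0; rewrite mulr_ge0// ltW.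
  have h2 : n.+1%:R * pm <= n.+1%:R * qm by rewrite ler_wpM2l.
  have h3 : 1 * (n.+1%:R * qm) <= T%:R * (n.+1%:R * qm).
    by rewrite ler_wpM2r// mulr_ge0// ltW.
  by lra.
have lamB' (g : R) : `|g| = 1 -> `|g * lam| * B <= 2^-1.
  by move=> g1; rewrite normrM g1 mul1r gtr0_norm.
have noise_guard (g : R) : `|g| = 1 -> exists V, [/\ measurable V,
    (P V <= (2 * (n.+1%:R * x))%:E)%E &
    forall S w, active S -> ~ V w ->
      ~ (5 * L * #|S|%:R <= noise_sum A f T u N X (cut_sign R S) (g * lam) B w)].
  move=> g1.
  have [|S aS|V [mV PV VP]] := guard (fun S => [set w |
    5 * L * #|S|%:R <= noise_sum A f T u N X (cut_sign R S) (g * lam) B w]).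
  - move=> S; apply: mle_event.
    exact: (measurable_noise_sum T u N X hA hf hfc).
  - apply: (noise_tail hA hf hfc hmodel) => //.
    + by move=> y i j Ay; apply: sB.
    + move=> i j; rewrite /cut_sign.
      by case: (i \in S); case: (j \in S); rewrite /= ?subrr ?subr0 ?sub0r ?normrN ?normr1 ?normr0.
    + exact: lamB'.
  - by exists V.
have [V3 [mV3 PV3 V3P]] := noise_guard 1 (normr1 _).
have [V4 [mV4 PV4 V4P]] := noise_guard (-1) (normrN1 _).
have [V0 [mV0 PV0 V0P]] := filterI (counts_le hmodel) (outcomes_in hA hmodel).
pose V := V0 `|` (V1 `|` (V2 `|` (V3 `|` V4))).
have mV : measurable V by do 4!apply: measurableU => //.
exists (~` V); split; first exact: measurableC.
  rewrite probability_setC// EFinB leeB// (_ : 7 * _ = 0 +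
    (2 * (n.+1%:R * x) + (n.+1%:R * x + (2 * (n.+1%:R * x) + 2 * (n.+1%:R * x))))); last by ring.
  rewrite !EFinD.
  apply: (le_trans (measureU2 P mV0 _)); first by do 3!apply: measurableU => //.
  apply: leeD; first by rewrite [X in (X <= _)%E]PV0.
  apply: (le_trans (measureU2 P mV1 _)); first by do 2!apply: measurableU => //.
  apply: leeD => //.
  apply: (le_trans (measureU2 P mV2 _)); first by apply: measurableU => //.
  apply: leeD.
    by apply: (le_trans PV2); rewrite lee_fin sumr_const card_ord -[leLHS]mulr_natl.
  by apply: (le_trans (measureU2 P mV3 mV4)); exact: leeD.
move=> w Vw.
have [w0 [w1 [w2 [w3 w4]]]] : ~ V0 w /\ ~ V1 w /\ ~ V2 w /\ ~ V3 w /\ ~ V4 w.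
  split=> [h|]; first by apply: Vw; left.
  split=> [h|]; first by apply: Vw; right; left.
  split=> [h|]; first by apply: Vw; right; right; left.
  by split=> h; apply: Vw; right; right; right; [left|right].
have [NT XA] : (forall i j : 'I_n.+1, (i < j)%N -> (N i j w <= T)%N) /\
    (forall i j : 'I_n.+1, (i < j)%N -> forall t : 'I_T, (t < N i j w)%N -> A (X i j t w)).
  by apply: contrapT => h; apply: w0; apply: V0P.
have deg k : \sum_(ij in pairs_at k) (N ij.1 ij.2 w)%:R <= D * m.
  rewrite leNgt; apply/negP => h; apply: w2; apply: (V2P k) => /=.
  by rewrite mul1r ltW.
apply: (@mle_of_events R kind A f n u (fun i j => N i j w) (fun i j t => X i j t w)
  M sigma m D eta l hA hf hfc) => //.
- by move=> i j ij; apply: (count_sym hmodel).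
- by move=> i j t ij tN; apply: (outcome_antisym hmodel).
- move=> i j t ij tN; have tT : (t < T)%N := leq_trans tN (NT i j ij).
  exact: (XA i j ij (Ordinal tT)).
- exact: (model_anchored hmodel).
- move=> S S0 Sn; have aS : active S by rewrite /active S0.
  have /negP := V1P S w aS w1; rewrite /= -ltNge; lra.
- move=> S S0 Sn; have aS : active S by rewrite /active S0.
  have /negP := V3P S w aS w3; rewrite -ltNge noise_sumE//.
  have /negP := V4P S w aS w4; rewrite -ltNge noise_sumE//.
  set q := \sum_(ij in cut_pairs S) _; set z := \sum_(ij | _) _.
  (* Each comparison across the cut is charged to its endpoint in [S], so the degree event bounds
     the random compensator by a multiple of [#|S|]. *)
  have qle : q <= #|S|%:R * (D * m).
    rewrite /q -(@sum_cut_sym _ _ S (fun i j => (N i j w)%:R)); last first.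
      by move=> i j ij; rewrite (count_sym hmodel).
    rewrite mulr_natl -sumr_const; apply: ler_sum => i iS; apply: le_trans (deg i).
    rewrite -(@sum_at_sym _ _ i (fun i j => (N i j w)%:R)); last first.
      by move=> i' j ij; rewrite (count_sym hmodel).
    rewrite big_mkcond [leRHS]big_mkcond; apply: ler_sum => j _ /=.
    rewrite inE; case: eqVneq => [->|ji]; first by rewrite iS.
    by case: ifP => // _; rewrite (count_sym hmodel) 1?eq_sym.
  have bB : (1 * lam * B) ^+ 2 = (lam * B) ^+ 2 by ring.
  have bB' : (-1 * lam * B) ^+ 2 = (lam * B) ^+ 2 by ring.
  rewrite bB bB' => h1 h2.
  have h3 : 2 * (lam * B) ^+ 2 * q <= 2 * (lam * B) ^+ 2 * (#|S|%:R * (D * m)).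
    by rewrite ler_wpM2l// mulr_ge0// sqr_ge0.
  have h4 : #|S|%:R * (5 * L + 2 * (lam * B) ^+ 2 * (D * m)) <=
      #|S|%:R * (lam * (sigma * (eta / 2 * m))) by rewrite ler_wpM2l.
  rewrite -(ler_pM2l lam0) -{1}(gtr0_norm lam0) -normrM ler_norml.
  by apply/andP; split; lra.
Qed.

(** * Choice of the parameters and conclusion *)

Lemma near_ln_ge (R : realType) (L0 : R) : \forall n \near \oo, L0 <= ln n%:R.
Proof.
near=> n; rewrite -[L0]expRK ler_ln ?posrE ?expR_gt0//.
  by near: n; exact: nbhs_infty_ger.
by apply: lt_le_trans (expR_gt0 L0) _; near: n; exact: nbhs_infty_ger.
Unshelve. all: by end_near. Qed.

(** The inequality x <= e^x at x = L / (k + 1), raised to the power k + 1, beats c L^k for large L.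
    With L = log n it shows that the prescribed lower bound on the rates is eventually at most 1. *)
Lemma powR_le_expR (R : realType) (c s : R) : 0 < c -> 0 <= s ->
  exists2 L0 : R, 1 <= L0 & forall L, L0 <= L -> c * L `^ s <= expR L.
Proof.
move=> c0 s0; pose k := (Num.truncn s).+1.
have sk : s <= k%:R by have /andP[_ /ltW] := truncn_itv s0.
exists (Num.max 1 (c * k.+1%:R ^+ k.+1)); first by rewrite le_max lexx.
move=> L; rewrite ge_max => /andP[L1 Lc].
have L0 : 0 <= L by exact: le_trans L1.
apply: (@le_trans _ _ (c * L ^+ k)).
  by rewrite ler_pM2l// -powR_mulrn// ler_powR.
apply: (@le_trans _ _ ((L / k.+1%:R) ^+ k.+1)).
  rewrite expr_div_n ler_pdivlMr ?exprn_gt0 ?ltr0n// mulrAC exprS.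
  by rewrite ler_wpM2r// exprn_ge0.
rewrite -[leRHS](_ : expR (L / k.+1%:R) ^+ k.+1 = _); last first.
  by rewrite -expRM_natr divfK ?pnatr_eq0.
rewrite lerXn2r ?nnegrE ?expR_ge0 ?divr_ge0//.
by apply: le_trans (expR_ge1Dx _); rewrite lerDr.
Qed.

Lemma powR_small (R : realType) (a y0 : R) : 0 < a -> 0 < y0 ->
  exists2 L0 : R, 1 <= L0 & forall L, L0 <= L -> L `^ (- a) <= y0.
Proof.
move=> a0 y00; exists (Num.max 1 (y0^-1 `^ a^-1)); first by rewrite le_max lexx.
move=> L; rewrite ge_max => /andP[L1 Ly].
have L0 : 0 < L by exact: lt_le_trans L1.
rewrite powRN -[leRHS]invrK lef_pV2 ?posrE ?invr_gt0 ?powR_gt0//.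
have -> : y0^-1 = (y0^-1 `^ a^-1) `^ a.
  by rewrite -powRrM mulVf ?gt_eqF// powRr1// invr_ge0 ltW.
apply: ge0_ler_powR => //; first exact: ltW.
  by rewrite nnegrE powR_ge0.
by rewrite nnegrE ltW.
Qed.

(** The choice lam^2 = L / (n pm) balances the two noise contributions: the level 5 L and the
    compensator both become multiples of L. [C] and [L0] are fixed before n and [pm], so the final
    rate is uniform. *)
Lemma numeric_parameters (R : realType) (c B sigma K eps : R) (T : nat) :
  0 < c -> 0 <= B -> 0 < sigma -> 1 <= K -> 0 < eps -> (1 <= T)%N ->
  exists C L0 : R, [/\ 0 < C, 2 <= L0 & forall (n : nat) (pm : R),
    (0 < n)%N -> L0 <= ln n%:R -> c * (ln n%:R `^ (3 + eps) / n%:R) <= pm ->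
    let m := n%:R * pm / 8 in let L := ln n%:R in
    exists lam D eta (l : nat),
    [/\ [/\ 0 < lam, lam * B <= 2^-1, 40 * L <= n%:R * pm & 0 < D],
        4 * (T%:R * (n%:R * (K * pm))) <= D * m, 0 < eta,
        5 * L + 2 * (lam * B) ^+ 2 * (D * m) <= lam * (sigma * (eta / 2 * m)) &
        [/\ n%:R < (1 + (2 * D)^-1) ^+ l, 2 * l%:R * eta < 1 &
            2 * l%:R * eta <= C * L `^ (- (eps / 2))]]].
Proof.
move=> c0 B0 sigma0 K1 eps0 T1.
have T0 : 0 < T%:R :> R by rewrite ltr0n.
have K0 : 0 < K by exact: lt_le_trans K1.
(* With [m] equal to n pm / 8, the factor 32 = 4 * 8 turns the degree condition into an equality. *)
pose D := 32 * T%:R * K.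
have D0 : 0 < D by rewrite !mulr_gt0.
pose rho := 1 + (2 * D)^-1.
have rho1 : 1 < rho by rewrite ltrDl invr_gt0 mulr_gt0.
have lnrho : 0 < ln rho by exact: ln_gt0.
(* Solves the noise condition with equality when [eta] is [C1 * lam]. *)
pose C1 := 16 * (5 + B ^+ 2 * D / 4) / sigma.
have C10 : 0 < C1.
  by rewrite divr_gt0// mulr_gt0// ltr_pwDl// divr_ge0// mulr_ge0 ?sqr_ge0// ltW.
pose C2 := (ln rho)^-1 + 1.
have C20 : 0 < C2 by rewrite addr_gt0// invr_gt0.
pose rc := Num.sqrt c; have rc0 : 0 < rc by rewrite sqrtr_gt0.
have rcE : rc ^+ 2 = c by rewrite sqr_sqrtr// ltW.
pose C := 2 * C2 * C1 / rc.
have C0 : 0 < C by rewrite divr_gt0// mulr_gt0// mulr_gt0.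
(* The three thresholds yield, in order, lam B <= 1/2, 40 L <= n pm (through 49 = 7^2), and 2 l eta
   <= 1/2. *)
pose y0 := Num.min (rc / (2 * B + 1)) (Num.min (rc / 7) (2^-1 / C)).
have bB0 : 0 < 2 * B + 1 by rewrite ltr_wpDl// mulr_ge0.
have y00 : 0 < y0 by rewrite !lt_min; apply/and3P; split; rewrite divr_gt0.
have e2 : 0 < eps / 2 by rewrite divr_gt0.
have [L0 L01 L0y] := powR_small e2 y00.
exists C, (L0 + 1); split=> //; first by lra.
move=> n pm n0 Ln hpm m L.
have n0' : 0 < n%:R :> R by rewrite ltr0n.
have L1 : 1 <= L by rewrite /L; lra.
have Lgt0 : 0 < L by lra.
pose y := L `^ (- (eps / 2)).
have y_gt0 : 0 < y by exact: powR_gt0.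
have : y <= y0 by apply: L0y; rewrite /L; lra.
rewrite /y0 !le_min => /and3P[yB y7 yC].
have LE : L `^ (3 + eps) * y ^+ 2 = L ^+ 3.
  rewrite /y -powR_mulrn ?powR_ge0// -powRrM -powRD; last first.
    by rewrite (gt_eqF Lgt0) implybT.
  by rewrite -powR_mulrn ?ltW//; congr (_ `^ _); field.
have npm : c * L ^+ 3 <= n%:R * pm * y ^+ 2.
  rewrite -LE mulrA ler_pM2r ?exprn_gt0//.
  by move: hpm; rewrite mulrA ler_pdivrMr// mulrC [pm * _]mulrC mulrC.
have npm0 : 0 < n%:R * pm.
  have : 0 < n%:R * pm * y ^+ 2 by apply: lt_le_trans npm; rewrite mulr_gt0// exprn_gt0.
  by rewrite pmulr_lgt0// exprn_gt0.
pose lam := Num.sqrt (L / (n%:R * pm)).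
have lam0 : 0 < lam by rewrite sqrtr_gt0 divr_gt0.
have lamE : lam ^+ 2 * (n%:R * pm) = L.
  by rewrite sqr_sqrtr ?divfK ?gt_eqF// divr_ge0 ?ltW.
have lam_ge0 := ltW lam0; have L_ge0 := ltW Lgt0; have rc_ge0 := ltW rc0.
have y_ge0 := ltW y_gt0.
(* The square of the left side is c L^3 / (n pm): one power of L comes from lam^2 and two from the
   square of the number of steps. This is what the 3 in the exponent 3 + eps pays for. *)
have lamy : lam * L * rc <= y.
  suff : (lam * L * rc) ^+ 2 <= y ^+ 2.
    by rewrite ler_sqr// nnegrE !mulr_ge0.
  rewrite -(ler_pM2l npm0) !exprMn rcE.
  have -> : n%:R * pm * (lam ^+ 2 * L ^+ 2 * c) = lam ^+ 2 * (n%:R * pm) * L ^+ 2 * c by ring.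
  by rewrite lamE; apply: le_trans npm; rewrite le_eqVlt; apply/orP; left; apply/eqP; ring.
have lamrc : lam * rc <= y.
  apply: le_trans lamy; by rewrite mulrAC ler_peMr// mulr_ge0.
pose eta := C1 * lam.
have eta0 : 0 < eta by rewrite mulr_gt0.
pose l := (Num.truncn (L / ln rho)).+1.
have Lr0 : 0 <= L / ln rho by rewrite divr_ge0 ?ltW.
have /andP[l1 l2] := truncn_itv Lr0.
have lC : l%:R <= C2 * L.
  rewrite /l -natr1 /C2 mulrDl mul1r.
  by apply: lerD => //; apply: le_trans l1 _; rewrite mulrC.
have rate : 2 * l%:R * eta <= C * y.
  apply: (@le_trans _ _ (2 * (C2 * L) * eta)).
    by rewrite ler_pM2r// ler_pM2l.
  have -> : 2 * (C2 * L) * eta = (2 * C2 * C1 / rc) * (lam * L * rc).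
    by rewrite /eta; field; rewrite gt_eqF.
  by rewrite -/C ler_pM2l.
exists lam, D, eta, l; split.
- split=> //.
  + have : y * (2 * B + 1) <= rc by rewrite -ler_pdivlMr.
    move=> h; have : lam * rc * (2 * B + 1) <= rc.
      by apply: le_trans h; rewrite ler_pM2r.
    rewrite mulrAC -[leRHS]mul1r ler_pM2r//; lra.
  + have : y * 7 <= rc by rewrite -ler_pdivlMr.
    move=> h; have h2 : (y * 7) ^+ 2 <= c.
      by rewrite -rcE lerXn2r// nnegrE mulr_ge0.
    rewrite -(@ler_pM2r _ (y ^+ 2)) ?exprn_gt0//; apply: le_trans npm.
    have h3 : L <= L ^+ 3 by rewrite -[leLHS]expr1 ler_weXn2l.
    apply: (@le_trans _ _ (c * L)); last by rewrite ler_pM2l.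
    have h4 : (y * 7) ^+ 2 * L <= c * L by rewrite ler_pM2r.
    have h5 : 0 <= y ^+ 2 * L by rewrite mulr_ge0 ?sqr_ge0.
    by move: h4; rewrite exprMn; lra.
- by rewrite /D /m; lra.
- exact: eta0.
- have -> : 5 * L + 2 * (lam * B) ^+ 2 * (D * m) =
      lam ^+ 2 * (n%:R * pm) * (5 + B ^+ 2 * D / 4).
    by rewrite /m -{1}lamE; field.
  have -> : lam * (sigma * (eta / 2 * m)) = lam ^+ 2 * (n%:R * pm) * (5 + B ^+ 2 * D / 4).
    by rewrite /eta /C1 /m; field; rewrite gt_eqF.
  exact: lexx.
- split=> //.
  + rewrite -[ltLHS]lnK ?posrE// -/rho -[X in X ^+ _]lnK ?posrE; last exact: lt_trans rho1.
    by rewrite -expRM_natl ltr_expR -ltr_pdivrMr.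
  + apply: le_lt_trans rate _; apply: (@le_lt_trans _ _ (C * (2^-1 / C))).
      by rewrite ler_pM2l.
    by rewrite mulrCA divff ?gt_eqF// mulr1; lra.
Qed.

(** If all scores vanished at 0, every f(x; .) would have its strict maximum at 0, contradicting
    monotonicity for x < 0. By symmetry [A] would lie in {0}, where total mass 1 for both y = 0 and
    y = 1 is impossible. The point obtained gives the numerator of [omega] a positive lower bound
    independent of n. *)
Lemma score_nonzero (R : realType) (kind : outcome_kind) (A : set R)
    (f : R -> R -> R) :
  outcome_set kind A -> valid kind A f -> strictly_log_concave A f ->
  exists2 x, A x & score f x 0 != 0.
Proof.
move=> hA hf hfc; apply: contrapT => noscore.
have flat x y : A x -> y != 0 -> f x y < f x 0.
  move=> Ax y0; have s0 : score f x 0 = 0.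
    by apply/eqP/negPn/negP => ?; apply: noscore; exists x.
  have := log_tangent_strict hfc Ax y0; rewrite s0 mul0r addr0.
  by rewrite ltr_ln ?posrE//; exact: (valid_pos hf).
have negA x : A x -> 0 <= x.
  move=> Ax; rewrite leNgt; apply/negP => x0.
  have := flat x (-1) Ax; rewrite oppr_eq0 oner_eq0 => /(_ isT).
  by rewrite ltNge (valid_decr hf Ax x0)//; lra.
have A0 : A `<=` [set 0].
  move=> x Ax /=; apply/eqP; rewrite eq_le negA// andbT.
  by rewrite -oppr_ge0 negA//; case: hA => + _; exact.
have := valid_int hf 0; have := valid_int hf 1; rewrite /base_integral.
case: (kind); first by rewrite (integral_Sset1 _ A0) => /esym/eqP; rewrite onee_eq0.
have [A00|A00] := pselect (A 0).
  have -> : A = [set 0] by apply/seteqP; split=> // x ->.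
  rewrite !esum_set1 ?lee_fin; [|exact/ltW/(valid_pos hf)|exact/ltW/(valid_pos hf)].
  move=> [f1] [f0]; have := flat 0 1 A00 (oner_neq0 _).
  by rewrite f1 f0 ltxx.
have -> : A = set0.
  by rewrite -subset0 => x Ax; apply: A00; rewrite -(A0 _ Ax).
by rewrite esum_set0 => /esym/eqP; rewrite onee_eq0.
Qed.

(** A bounded ratio alone bounds neither of its terms. The fixed point ([x0], 0) lies in both
    ranges, so it bounds the supremum from below and the infimum from above; the ratio then gives
    the opposite bounds, with constants that do not involve [M]. *)
Lemma omega_bounds (R : realType) (A : set R) (f : R -> R -> R) (M K x0 : R) :
  0 <= M -> A x0 -> score f x0 0 != 0 -> (omega A f M <= K%:E)%E ->
  [/\ 0 < K,
    forall x y, A x -> `|y| <= M -> `|score f x y| <= K * `|dscore f x0 0| &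
    forall x y, A x -> `|y| <= M + 1 -> `|score f x0 0| / K <= `|dscore f x y| ].
Proof.
move=> M0 Ax0 s0; rewrite /omega.
set S := ereal_sup _; set I := ereal_inf _ => SI.
have Sub x y : A x -> `|y| <= M -> (`|score f x y|%:E <= S)%E.
  by move=> Ax yM; apply: ereal_sup_ubound; exists (x, y).
have Ilb x y : A x -> `|y| <= M + 1 -> (I <= `|dscore f x y|%:E)%E.
  by move=> Ax yM; apply: ereal_inf_lbound; exists (x, y).
have M1 : `|0 : R| <= M + 1 by rewrite normr0; lra.
have M0' : `|0 : R| <= M by rewrite normr0.
have I0 : (0 <= I)%E by apply: le_ereal_inf_tmp => _ [[x y] _ <-]; rewrite lee_fin.
have Ifin : I \is a fin_num.
  by rewrite ge0_fin_numE//; apply: le_lt_trans (Ilb x0 0 Ax0 M1) (ltry _).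
have s0' : 0 < `|score f x0 0| by rewrite normr_gt0.
have S0 : (0 < S)%E by apply: lt_le_trans (Sub x0 0 Ax0 M0'); rewrite lte_fin.
have r0 := fine_ge0 I0; have IE := fineK Ifin.
move: (fine I) r0 IE => r r0 IE; rewrite -IE in SI.
(* A zero infimum would make the ratio infinite, the supremum being positive. *)
have {}r0 : 0 < r.
  rewrite lt_def r0 andbT; apply/eqP => rE; move: SI.
  by rewrite rE inver eqxx gt0_muley// leye_eq.
have SK : (S <= (K * r)%:E)%E.
  by move: SI; rewrite inver gt_eqF// lee_pdivrMr// -EFinM.
have sK : `|score f x0 0| <= K * r.
  by rewrite -lee_fin; apply: le_trans SK; exact: Sub.
have K0 : 0 < K by rewrite -(pmulr_lgt0 _ r0); exact: lt_le_trans sK.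
have rle x y : A x -> `|y| <= M + 1 -> r <= `|dscore f x y|.
  by move=> Ax yM; rewrite -lee_fin IE; exact: Ilb.
split=> // x y Ax yM.
  rewrite -lee_fin; apply: (le_trans (Sub x y Ax yM)); apply: (le_trans SK).
  by rewrite lee_fin ler_pM2l//; exact: rle.
by apply: le_trans (rle x y Ax yM); rewrite ler_pdivrMr// mulrC.
Qed.

(** The sets [good n] may fail to be measurable, so Borel-Cantelli is applied to the complements
    [F n] of measurable subsets of them. *)
Lemma borel_cantelli_inv_sq (R : realType) (d : measure_display)
    (Omega : measurableType d) (P : probability Omega R)
    (good : nat -> set Omega) :
  (\forall n \near \oo, exists E : set Omega, [/\ measurable E,
     ((1 - n%:R ^- 2)%:E <= P E)%E & E `<=` good n]) ->
  {ae P, forall w, \forall n \near \oo, good n w}.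
Proof.
move=> [N0 _ hE].
have /choice[F FP] : forall n, exists F : set Omega, [/\ measurable F,
    (P F <= (if n == 0%N then 0 else n%:R ^- 2)%:E)%E &
    (N0.+1 <= n)%N -> ~` F `<=` good n].
  move=> n; have [Nn|nN] := leqP N0.+1 n; last first.
    exists set0; split=> //; rewrite measure0 lee_fin.
    by case: ifP.
  have [E [mE PE Eg]] := hE n (ltnW Nn).
  exists (~` E); split=> //; [exact: measurableC| |by rewrite setCK].
  rewrite probability_setC// gtn_eqF ?(leq_trans _ Nn)//.
  have PEfin : P E \is a fin_num by exact: fin_num_measure.
  by move: PE; rewrite -(fineK PEfin) -EFinB !lee_fin; lra.
have mF n : measurable (F n) by have [] := FP n.
(* Telescoping: 2 / t - 2 / (t + 1) >= 1 / t^2 for t >= 1. The term of index 0 is zero by the choice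
   of [F]. *)
have partial n : (\sum_(0 <= k < n.+1) P (F k) <= (2 - 2 / n.+1%:R)%:E)%E.
  elim: n => [|n IH].
    rewrite big_nat1; have [_ h _] := FP 0%N; apply: (le_trans h).
    by rewrite lee_fin divr1; lra.
  rewrite big_nat_recr//=; have [_ h _] := FP n.+1.
  apply: (le_trans (leeD IH h)); rewrite -EFinD lee_fin/=.
  have n1 : 0 < n.+1%:R :> R by rewrite ltr0n.
  have n2 : 1 <= n.+1%:R :> R by rewrite ler1n.
  rewrite -[n.+2%:R]natr1; set t : R := n.+1%:R in n1 n2 *.
  rewrite -subr_ge0.
  have -> : 2 - 2 / (t + 1) - (2 - 2 / t + t ^- 2) = (t - 1) / (t ^+ 2 * (t + 1)).
    by field; rewrite !gt_eqF//; lra.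
  by rewrite divr_ge0 ?subr_ge0// mulr_ge0 ?sqr_ge0//; lra.
have sumF : (\sum_(n <oo) P (F n) < +oo)%E.
  apply: (@le_lt_trans _ _ 2%:E); last exact: ltry.
  apply: lime_le; first exact: is_cvg_nneseries.
  exists 1%N => // n /= n1; case: n n1 => // n _.
  by apply: (le_trans (partial n)); rewrite lee_fin gerBl divr_ge0.
have mlim : measurable (lim_sup_set F).
  by apply: bigcap_measurable => // k _; exact: bigcup_measurable.
exists (lim_sup_set F); split=> //; first exact: lim_sup_set_cvg0.
move=> w /= nw; apply: contrapT => wlim; apply: nw.
have [m hm] : exists m, forall n, (m <= n)%N -> ~ F n w.
  apply: contrapT => h; apply: wlim => m _; apply: contrapT => h2; apply: h.
  by exists m => n mn Fn; apply: h2; exists n.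
exists (maxn m N0.+1) => // n /=; rewrite geq_max => /andP[mn Nn].
by have [_ _ h] := FP n; apply: h => //; exact: hm.
Qed.

Theorem corollary1 (R : realType) (kind : outcome_kind) (A : set R)
    (f : R -> R -> R) (T : nat)
    (d : measure_display) (Omega : measurableType d) (P : probability Omega R)
    (u : forall n : nat, 'rV[R]_n)
    (p : forall n : nat, 'I_n -> 'I_n -> R)
    (N : forall n : nat, 'I_n -> 'I_n -> {RV P >-> nat})
    (X : forall n : nat, 'I_n -> 'I_n -> nat -> {RV P >-> R})
    (eps c : R)
    (hA : outcome_set kind A)
    (hAb : bounded_set A)
    (hf : valid kind A f)
    (hfc : strictly_log_concave A f)
    (hT : (1 <= T)%N)
    (hmodel : forall n : nat,
      sampling_model kind A f T (u n) (p n) (N n) (X n))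
    (hbnd : exists K : R, forall n : nat,
      (Order.max (Order.max (dynamic_range (u n))%:E
                            (omega A f (dynamic_range (u n))))
                 (max_rate (p n) / min_rate (p n))%:E <= K%:E)%E)
    (heps : 0 < eps) (hc : 0 < c)
    (hp : forall n : nat,
      c * (ln n%:R `^ (3 + eps) / n%:R) <= 1 ->
      c * (ln n%:R `^ (3 + eps) / n%:R) <= min_rate (p n)) :
  {ae P, forall w, \forall n \near \oo,
    exists! v : 'rV[R]_n, is_mle f (fun i j => N n i j w)
                                   (fun i j t => X n i j t w) v}
  /\
  exists2 C : R, 0 < C &
    \forall n \near \oo, exists E : set Omega,
      [/\ measurable E,
          ((1 - n%:R ^- 2)%:E <= P E)%E
        & forall w, E w -> exists v : 'rV[R]_n,
            unique (is_mle f (fun i j => N n i j w)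
                             (fun i j t => X n i j t w)) v /\
            `|v - u n| <= C * ln n%:R `^ (- (eps / 2))].
Proof.
suff [C C0 main] : exists2 C : R, 0 < C &
    \forall n \near \oo, exists E : set Omega,
      [/\ measurable E,
          ((1 - n%:R ^- 2)%:E <= P E)%E
        & forall w, E w -> exists v : 'rV[R]_n,
            unique (is_mle f (fun i j => N n i j w)
                             (fun i j t => X n i j t w)) v /\
            `|v - u n| <= C * ln n%:R `^ (- (eps / 2))].
  split; last by exists C.
  apply: borel_cantelli_inv_sq; apply: filterS main => n [E [mE PE EP]].
  by exists E; split=> // w /EP[v [uv _]]; exists v.
case: hbnd => K hK.
have [x0 Ax0 s0] := score_nonzero hA hf hfc.
have M0 n : 0 <= dynamic_range (u n) by exact: bigmax_ge_id.
have uM n i j : `|u n ord0 i - u n ord0 j| <= dynamic_range (u n).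
  exact: (le_bigmax 0 (fun ij : 'I_n * 'I_n => `|u n ord0 ij.1 - u n ord0 ij.2|) (i, j)).
have hom n : (omega A f (dynamic_range (u n)) <= K%:E)%E.
  by apply: le_trans (hK n); rewrite !le_max lexx orbT.
have hrate n : max_rate (p n) / min_rate (p n) <= K.
  by rewrite -lee_fin; apply: le_trans (hK n); rewrite le_max lexx orbT.
(* Index 0 is used only for the sign of [K]; [B] and [sigma] below refer to the fixed point ([x0],
   0) and thus serve every n. *)
have [K0 _ _] := omega_bounds (M0 0%N) Ax0 s0 (hom 0%N).
pose B := K * `|dscore f x0 0|.
pose sigma := `|score f x0 0| / K.
have B0 : 0 <= B by rewrite mulr_ge0// ltW.
have sigma0 : 0 < sigma by rewrite divr_gt0// normr_gt0.
(* The maximum with 1 makes [K1 * min_rate (p n)] an upper rate that is visibly at least the lower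
   one. *)
pose K1 := Num.max 1 K.
have K11 : 1 <= K1 by rewrite le_max lexx.
have eps3 : 0 <= 3 + eps by rewrite addr_ge0// ltW.
have [C [L0 [C0 L02 par]]] := @numeric_parameters R c B sigma K1 eps T hc B0 sigma0 K11 heps hT.
have [L1 _ hL1] := powR_le_expR hc eps3.
exists C => //.
suff step n : (0 < n)%N -> Num.max L0 L1 <= ln n%:R -> exists E : set Omega,
      [/\ measurable E,
          ((1 - n%:R ^- 2)%:E <= P E)%E
        & forall w, E w -> exists v : 'rV[R]_n,
            unique (is_mle f (fun i j => N n i j w)
                             (fun i j t => X n i j t w)) v /\
            `|v - u n| <= C * ln n%:R `^ (- (eps / 2))].
  near=> n; apply: step; first by near: n; exact: nbhs_infty_gt.
  by near: n; exact: near_ln_ge.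
move=> n0 Ln.
move: Ln; rewrite ge_max => /andP[LL0 LL1].
have n0' : 0 < n%:R :> R by rewrite ltr0n.
have Lpos : 2 <= ln n%:R :> R by apply: le_trans LL0.
have pmge : c * (ln n%:R `^ (3 + eps) / n%:R) <= min_rate (p n).
  apply: hp; rewrite mulrA ler_pdivrMr// mul1r -[leRHS]lnK ?posrE//.
  exact: hL1.
have pm0 : 0 < min_rate (p n).
  by apply: lt_le_trans pmge; rewrite mulr_gt0// divr_gt0// powR_gt0//; lra.
have := par n (min_rate (p n)) n0 LL0 pmge.
clear pmge LL0 LL1.
case: n n0 n0' Lpos pm0 => // n _ n0' Lpos pm0 /=.
move=> [lam [D [eta [l [[lam0 lamB Lp D0] Dm eta0 noise [nl small rate]]]]]].
have pmq i j : i != j -> min_rate (p n.+1) <= p n.+1 i j <= K1 * min_rate (p n.+1).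
  move=> ij; apply/andP; split; first exact: (bigmin_le_cond 1 (j := (i, j))).
  apply: (@le_trans _ _ (max_rate (p n.+1))).
    exact: (le_bigmax_cond 0 (j := (i, j)) (fun ij : 'I_n.+1 * 'I_n.+1 => p n.+1 ij.1 ij.2)).
  by rewrite -ler_pdivrMr//; apply: le_trans (hrate n.+1) _; rewrite le_max lexx orbT.
have [_ sB curv] := omega_bounds (M0 n.+1) Ax0 s0 (hom n.+1).
have nx k : n.+1%:R * expR (- (k * ln n.+1%:R)) = expR (- ((k - 1) * ln n.+1%:R)) :> R.
  by rewrite -[X in X * _]lnK ?posrE// -expRD; congr expR; ring.
have [||||||||||||||||||E [mE PE EP]] := @mle_high_probability R kind A f T d Omega P n
  (u n.+1) (p n.+1) (N n.+1) (X n.+1) (dynamic_range (u n.+1)) B sigma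
  (min_rate (p n.+1)) (K1 * min_rate (p n.+1)) lam (ln n.+1%:R) D eta l
  hA hf hfc hT (hmodel n.+1) pm0.
- by rewrite ler_peMl// ltW.
- exact: pmq.
- exact: uM.
- exact: B0.
- exact: sB.
- exact: sigma0.
- move=> x y Ax y1 y2; have [_ _ d2] := hfc x y Ax.
  have := curv x y Ax; rewrite ler_norml y1 y2 => /(_ isT).
  by rewrite (ltr0_norm d2) lerNr.
- exact: lam0.
- exact: lamB.
- lra.
- exact: Lp.
- rewrite nx expRN lef_pV2 ?posrE ?expR_gt0//.
  by apply: le_trans (expR_ge1Dx _); lra.
- exact: D0.
- exact: Dm.
- exact: eta0.
- exact: noise.
- exact: nl.
- exact: small.
exists E; split=> //.
  (* The failure bound is 7 n^(-4), at most n^(-2) because n^2 = e^(2 log n) >= (1 + log n)^2 >= 9,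
     as log n >= 2. *)
  apply: le_trans PE; rewrite lee_fin lerD2l lerN2 nx.
  have -> : n.+1%:R ^- 2 = expR (- (2 * ln n.+1%:R)) :> R.
    by rewrite expRN expRM_natl lnK ?posrE.
  have -> : - ((5 - 1) * ln n.+1%:R) = - (2 * ln n.+1%:R) + - (2 * ln n.+1%:R) :> R by ring.
  rewrite expRD mulrA -[leRHS]mul1r ler_pM2r ?expR_gt0// expRN ler_pdivrMr ?expR_gt0// mul1r.
  rewrite expRM_natl; apply: (@le_trans _ _ ((1 + ln n.+1%:R) ^+ 2)).
    by rewrite expr2; nra.
  by rewrite lerXn2r ?nnegrE ?expR_ge0 ?expR_ge1Dx//; lra.
move=> w /EP[v [uv spread]]; exists v; split=> //.
have r0 : 0 <= C * ln n.+1%:R `^ (- (eps / 2)) by rewrite mulr_ge0 ?powR_ge0// ltW.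
(* Both vectors vanish at coordinate 0, so the spread of their difference bounds its sup norm. *)
have [[vanch _] _] := uv.
have uanch := model_anchored (hmodel n.+1).
apply: row_norm_le => // i; rewrite !mxE; apply: le_trans rate.
have := spread i ord0; have := spread ord0 i.
rewrite (vanch ord0)// (uanch ord0)// ler_norml; lra.
Unshelve. all: by end_near. Qed.
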